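(* Let $\mathbb{K}$ be a field and $R=\mathbb{K}[x_1,\dots,x_n]$. Let $I\subset R$ be a squarefree ass-decomposable monomial ideal with decomposing variable $x$ and index of irreducibility $r$. Then the following statements are equivalent: (i) $\mathrm{reg}(R/I)=r-1$; (ii) $d(I)=r$. If these conditions hold, then $I=\mathfrak{p}+xJ$, where $\mathfrak{p}$ is a monomial prime ideal and $J$ is an ass-decomposable monomial ideal.
   Context: $R$ has the standard grading. For a finitely generated graded $R$-module $M\ne0$, $\mathrm{reg}(M)=\sup\{j-i : \mathrm{Tor}_i^R(M,\mathbb{K})_j\neq0\}$ is the Castelnuovo-Mumford regularity; for a nonzero ideal $I$, $\mathrm{reg}(R/I)=\mathrm{reg}(I)-1$. For a monomial ideal $I$, $\mathcal{G}(I)$ is its minimal set of monomial generators and $d(I)=\max\{\deg(u) : u\in\mathcal{G}(I)\}$. If $I=\bigcap_{i=1}^r\mathfrak{p}_i$ is a minimal (irredundant) prime decomposition of a squarefree monomial ideal $I$, then $r$ is the index of irreducibility of $I$. A monomial prime ideal is an ideal generated by a (possibly empty) set of variables. For an ideal $I\subseteq R$, $\mathrm{ass}(I)$ is the set of associated primes of $R/I$. Recursively, a (proper) monomial ideal $I\subset R$ is called ass-decomposable if either it is a primary ideal, or else there exist a variable $x_i\notin\sqrt{I}$ and a positive integer $k$ such that (i) $\mathrm{ass}(I+(x_i^k))=\{\mathfrak{p}\in\mathrm{ass}(I) : x_i\in\mathfrak{p}\}$, and (ii) both $I+(x_i^k)$ and $I:x_i^k$ are ass-decomposable. Such a monomial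 $x_i^k$ is called a decomposing monomial of $I$; when $I$ is squarefree one necessarily has $k=1$, and $x_i$ is then called a decomposing variable of $I$. *)

(* Defs.v *)
From HB Require Import structures.
From mathcomp Require Import all_boot all_order all_algebra.
From mathcomp Require Import classical_sets.
From mathcomp Require Import mpoly.

Set Implicit Arguments.
Unset Strict Implicit.
Unset Printing Implicit Defensive.

Import GRing.Theory.
Local Open Scope classical_set_scope.
Local Open Scope ring_scope.

(* Ideals are subsets [set R]; equality of sets is extensional.  The library's
   [idealr_closed] includes properness (1 is not in the ideal). *)

Definition ideal_gen (R : comNzRingType) (S : set R) : set R :=
  [set f | exists s : seq (R * R),
     (forall p, p \in s -> S p.2) /\ f = \sum_(p <- s) p.1 * p.2].

Definition ideal_add (R : comNzRingType) (I J : set R) : set R :=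
  [set f | exists a b : R, [/\ I a, J b & f = a + b]].

Definition ideal_scale (R : comNzRingType) (g : R) (J : set R) : set R :=
  [set g * f | f in J].

Definition colon (R : comNzRingType) (I : set R) (g : R) : set R :=
  [set f | I (f * g)].

Definition radical (R : comNzRingType) (I : set R) : set R :=
  [set f | exists k : nat, I (f ^+ k)].

Definition is_proper_ideal (R : comNzRingType) (I : set R) : Prop :=
  idealr_closed (mem I).

Definition prime_ideal (R : comNzRingType) (p : set R) : Prop :=
  is_proper_ideal p /\ prime_idealr_closed (mem p).

Definition primary_ideal (R : comNzRingType) (I : set R) : Prop :=
  is_proper_ideal I /\ (forall f g : R, I (f * g) -> I f \/ radical I g).

(* The annihilator of the class of f in R/I is the colon ideal I : f. *)
Definition ass (R : comNzRingType) (I : set R) : set (set R) :=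
  [set p | prime_ideal p /\ exists f : R, p = colon I f].

Definition monomials_gen (n : nat) (K : fieldType) (M : set 'X_{1..n}) :
    set {mpoly K[n]} :=
  ideal_gen [set ('X_[m] : {mpoly K[n]}) | m in M].

Arguments monomials_gen {n} K M.

Definition monomial_ideal (n : nat) (K : fieldType) (I : set {mpoly K[n]}) :
    Prop :=
  exists M : set 'X_{1..n}, I = monomials_gen K M.

Definition squarefree_monomial_ideal (n : nat) (K : fieldType)
    (I : set {mpoly K[n]}) : Prop :=
  exists M : set 'X_{1..n},
    (forall m, M m -> forall i : 'I_n, (m i <= 1)%N) /\ I = monomials_gen K M.

Definition monomial_prime_ideal (n : nat) (K : fieldType)
    (p : set {mpoly K[n]}) : Prop :=
  exists A : {set 'I_n}, p = ideal_gen [set ('X_i : {mpoly K[n]}) | i in [set` A]].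

Definition minimal_monomial_generators (n : nat) (K : fieldType)
    (I : set {mpoly K[n]}) (G : set 'X_{1..n}) : Prop :=
  I = monomials_gen K G /\
  (forall G' : set 'X_{1..n}, G' `<=` G -> I = monomials_gen K G' -> G' = G).

(* [max_gen_degree I d] means d(I) = d. *)
Definition max_gen_degree (n : nat) (K : fieldType) (I : set {mpoly K[n]})
    (d : nat) : Prop :=
  exists G : set 'X_{1..n}, minimal_monomial_generators I G /\
    (exists2 u, G u & mdeg u = d) /\ (forall u, G u -> (mdeg u <= d)%N).

Definition irreducibility_index (n : nat) (K : fieldType)
    (I : set {mpoly K[n]}) (r : nat) : Prop :=
  exists P : 'I_r -> set {mpoly K[n]},
    [/\ forall i, prime_ideal (P i),
        I = \bigcap_(i in [set: 'I_r]) P i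
      & forall i, I <> \bigcap_(j in [set~ i]) P j].

Definition ideal_addX (n : nat) (K : fieldType) (I : set {mpoly K[n]})
    (i : 'I_n) (k : nat) : set {mpoly K[n]} :=
  ideal_add I (ideal_gen [set ('X_i ^+ k : {mpoly K[n]})]).

Definition colonX (n : nat) (K : fieldType) (I : set {mpoly K[n]})
    (i : 'I_n) (k : nat) : set {mpoly K[n]} :=
  colon I ('X_i ^+ k).

Definition ass_splits (n : nat) (K : fieldType) (I : set {mpoly K[n]})
    (i : 'I_n) (k : nat) : Prop :=
  [/\ ~ radical I 'X_i, (0 < k)%N
    & ass (ideal_addX I i k) = [set p | ass I p /\ p 'X_i]].

Inductive ass_decomposable (n : nat) (K : fieldType) (I : set {mpoly K[n]}) :
    Prop :=
| assdec_primary of monomial_ideal I & primary_ideal I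
| assdec_split (i : 'I_n) (k : nat) of
    monomial_ideal I & is_proper_ideal I & ass_splits I i k
    & ass_decomposable (ideal_addX I i k) & ass_decomposable (colonX I i k).

Definition decomposing_monomial (n : nat) (K : fieldType)
    (I : set {mpoly K[n]}) (i : 'I_n) (k : nat) : Prop :=
  [/\ ass_splits I i k, ass_decomposable (ideal_addX I i k)
    & ass_decomposable (colonX I i k)].

Definition decomposing_variable (n : nat) (K : fieldType)
    (I : set {mpoly K[n]}) (i : 'I_n) : Prop :=
  decomposing_monomial I i 1.

(* A graded free resolution ... -> F_1 -> F_0 -> R/I -> 0 by free modules of
   finite rank, not necessarily minimal: F_i is the direct sum of the
   R(- res_deg i k), its elements are row vectors and maps act by right
   multiplication.  The k-th basis vector of F_0 is sent to the class of
   [res_aug k 0] in R/I. *)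
Record graded_free_resolution (n : nat) (K : fieldType)
    (I : set {mpoly K[n]}) := GradedFreeResolution {
  res_rank : nat -> nat;
  res_deg : forall i, 'I_(res_rank i) -> int;
  res_d : forall i, 'M[{mpoly K[n]}]_(res_rank i.+1, res_rank i);
  res_aug : 'cV[{mpoly K[n]}]_(res_rank 0);
  res_d_homog : forall i (k : 'I_(res_rank i.+1)) (l : 'I_(res_rank i)) m,
    m \in msupp (res_d i k l) -> res_deg k = res_deg l + (mdeg m)%:Z;
  res_aug_homog : forall (k : 'I_(res_rank 0)) m,
    m \in msupp (res_aug k 0) -> res_deg k = (mdeg m)%:Z;
  res_surj : exists v : 'rV_(res_rank 0), I ((v *m res_aug) 0 0 - 1);
  res_exact0 : forall v : 'rV_(res_rank 0),
    I ((v *m res_aug) 0 0) <-> exists w, v = w *m res_d 0;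
  res_exact : forall i (v : 'rV_(res_rank i.+1)),
    v *m res_d i = 0 <-> exists w, v = w *m res_d i.+1
}.

(* The differential of F tensored with K = R/(x_1, ..., x_n). *)
Definition res_dK (n : nat) (K : fieldType) (I : set {mpoly K[n]})
    (F : graded_free_resolution I) (i : nat) :
    'M[K]_(res_rank F i.+1, res_rank F i) :=
  map_mx (mcoeff 0%MM) (res_d F i).

Definition res_cycle (n : nat) (K : fieldType) (I : set {mpoly K[n]})
    (F : graded_free_resolution I) (i : nat) : 'rV[K]_(res_rank F i) -> Prop :=
  match i with
  | 0%N => fun _ => True
  | i'.+1 => fun v => v *m res_dK F i' = 0
  end.

Definition res_in_degree (n : nat) (K : fieldType) (I : set {mpoly K[n]})
    (F : graded_free_resolution I) (i : nat) (j : int)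
    (v : 'rV[K]_(res_rank F i)) : Prop :=
  forall k, v 0 k != 0 -> res_deg k = j.

(* Tor_i(R/I, K)_j <> 0: the degree j part of H_i(F (x) K) is nonzero.  Tor does
   not depend on the resolution, so one resolution F suffices. *)
Definition tor_neq0 (n : nat) (K : fieldType) (I : set {mpoly K[n]})
    (i : nat) (j : int) : Prop :=
  exists (F : graded_free_resolution I) (v : 'rV[K]_(res_rank F i)),
    [/\ res_in_degree j v, res_cycle v
      & ~ exists w : 'rV[K]_(res_rank F i.+1),
            res_in_degree j w /\ v = w *m res_dK F i].

(* [regularity_quot I m] means reg(R/I) = m.  A finite supremum of a set of
   integers is attained. *)
Definition regularity_quot (n : nat) (K : fieldType) (I : set {mpoly K[n]})
    (m : int) : Prop :=
  (exists (i : nat) (j : int), tor_neq0 I i j /\ j - i%:Z = m) /\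
  (forall (i : nat) (j : int), tor_neq0 I i j -> j - i%:Z <= m).

(* Main.v *)
Require Import Defs.
From HB Require Import structures.
From mathcomp Require Import boolp classical_sets.
From mathcomp Require Import all_boot all_order all_algebra.
From mathcomp Require Import mpoly zify ring.

Set Implicit Arguments.
Unset Strict Implicit.
Unset Printing Implicit Defensive.

Import GRing.Theory Num.Theory.

(** Write r for the number of minimal primes of the squarefree ideal I.  The
proof bounds the regularity of R/I by r - 1 through the recursion that a
decomposing variable x provides, and follows the equality case down the same
recursion.

Regularity is measured by Koszul homology.  The Koszul complex of R/I is
bigraded by exterior degree i and by the degree e of the polynomial coefficients;
its homology in bidegree (i, e) is Tor_i(R/I, K) in degree i + e, so regularity
only sees e and exterior degrees may be summed over.  [kvanish I e] says that the
homology of R/I in coefficient degree e is zero.  Three facts govern it: it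
vanishes for the zero ideal when e is not 0 ([kvanish0], from the exactness
[koszul_exact]); adjoining a variable that is a nonzerodivisor modulo I preserves
vanishing ([kvanish_addvar]), hence it vanishes for monomial primes in every
nonzero degree; and the exact sequence of I : x, I and I + (x) gives vanishing for I
in degree e from vanishing for I + (x) in degree e and for I : x in degree e - 1
([kvanish_add_colon]).  A zigzag in the tensor product of a resolution with the
Koszul complex shows that Tor, computed from any resolution of R/I, is nonzero
only where Koszul homology is ([tor_neq0_kvanish]).

A squarefree ideal is the intersection of the primes generated by the members of
an antichain of sets of variables, and this antichain is ass(I) ([ass_capP]).
A decomposing variable forces exponent 1 and splits the antichain: I + (x) belongs
to the members containing x, of number b > 0, and I : x to the others, of number
a > 0, with a + b = r ([splits_exponent], [addX_capP], [colonX_capP]).  By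
induction the homology of I vanishes in degrees e >= r, since e >= b and
e - 1 >= a.  If it does not vanish for e = r - 1, then b = 1 and I : x is again
extremal, so I : x has a minimal generator of degree r - 1; multiplied by x, or in
one exceptional case replaced by a product of two variables, it becomes a minimal
generator of I of degree r ([mintrans_extend]).  Minimal generators are the
minimal sets of variables meeting every member of the antichain, so their degree
never exceeds r ([mintrans_card]).  This proves that (i) implies (ii).

Conversely a minimal generator of degree r gives Tor_1(R/I, K) in degree r: this is
read off a simplicial resolution ([tor1_neq0]), and the upper bound is already known.

Finally, b = 1 means that I + (x) is a prime generated by x and a set of variables
lying in I; hence I is generated by these variables and x (I : x)
([capP_with_var1]). *)

(** * Coefficients and forms *)

Section Coefficients.
Local Open Scope ring_scope.
Variables (K : fieldType) (n : nat).
Local Notation R := {mpoly K[n]}.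
Implicit Types (f g : R) (m : 'X_{1..n}).

Lemma mpoly_of_coeffs (E : 'X_{1..n} -> K) (B : nat) :
  (forall m, (B <= mdeg m)%N -> E m = 0) -> exists f : R, forall m, f@_m = E m.
Proof.
move=> EB; exists (\sum_(m : 'X_{1..n < B}) E m *: 'X_[m]) => m.
have [ltmB|leBm] := ltnP (mdeg m) B; first exact: mcoeff_mpoly.
rewrite EB // raddf_sum big1 // => k _ /=.
rewrite mcoeffZ mcoeffX; case: eqP => [km|_]; last by rewrite mulr0.
by move: (bmdeg k); rewrite km ltnNge leBm.
Qed.

Lemma mcoeffXM k f m :
  ('X_[k] * f)@_m = if (k <= m)%MM then f@_(m - k) else 0.
Proof.
rewrite mulrC; case: ifPn => [lekm|nlekm].
  by rewrite -{1}(submK lekm) addmC mcoeffMX.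
apply/eqP; rewrite mcoeff_eq0 (perm_mem (msuppMX f k)).
by apply: contra nlekm => /mapP[m' _ ->]; exact: lem_addr.
Qed.

Lemma mcoeff_sign N f m : ((-1) ^+ N * f)@_m = (-1) ^+ N * f@_m.
Proof.
rewrite -signr_odd mulr_sign -[in RHS]signr_odd mulr_sign.
by case: odd; rewrite ?mcoeffN.
Qed.

(** Degrees are integers because the twists of a graded resolution are; for
negative [e] only 0 is a form of degree [e]. *)
Definition isform (e : int) f := forall m, m \in msupp f -> (mdeg m)%:Z = e.

Lemma isformE e f m : isform e f -> (mdeg m)%:Z != e -> f@_m = 0.
Proof.
by move=> hf ne; apply: memN_msupp_eq0; apply: contra ne => /hf ->.
Qed.

Lemma isform0 e : isform e 0. Proof. by move=> m; rewrite msupp0. Qed.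

Lemma isformP e f : (forall m, (mdeg m)%:Z != e -> f@_m = 0) -> isform e f.
Proof.
by move=> fe m; rewrite mcoeff_msupp => fm; apply/eqP; apply: contraNT fm => /fe ->.
Qed.

Lemma isformD e f g : isform e f -> isform e g -> isform e (f + g).
Proof. by move=> hf hg; apply: isformP => m ne; rewrite mcoeffD !(@isformE e) ?addr0. Qed.

Lemma isformN e f : isform e f -> isform e (- f).
Proof. by move=> hf; apply: isformP => m ne; rewrite mcoeffN !(@isformE e) ?oppr0. Qed.

Lemma isformB e f g : isform e f -> isform e g -> isform e (f - g).
Proof. by move=> hf hg; apply: isformD => //; apply: isformN. Qed.

Lemma isform_sum e (T : Type) (s : seq T) (P : pred T) (F : T -> R) :
  (forall t, P t -> isform e (F t)) -> isform e (\sum_(t <- s | P t) F t).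
Proof. by move=> hF; elim/big_ind: _ => //; [exact: isform0 | exact: isformD]. Qed.

Lemma isformM d e f g : isform d f -> isform e g -> isform (d + e) (f * g).
Proof.
move=> hf hg m /msuppM_le /allpairsP[[m1 m2] /= [m1f m2g ->]].
by rewrite mdegD PoszD (hf _ m1f) (hg _ m2g).
Qed.

Lemma isformX (i : 'I_n) : isform 1 ('X_i : R).
Proof. by move=> m /mem_msuppXP <-; rewrite mdeg1. Qed.

Lemma isform_sign e N f : isform e f -> isform e ((-1) ^+ N * f).
Proof.
by move=> hf; rewrite -signr_odd mulr_sign; case: odd => //; apply: isformN.
Qed.

End Coefficients.

(** These replace [ffunE] on sums and multiples of chains: [ffunE] would also
unfold the Koszul differential, itself defined as a finite function. *)
Section FfunOperations.
Local Open Scope ring_scope.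
Variables (A : ringType) (M : lmodType A) (T : finType).
Implicit Types f g : {ffun T -> M}.

Lemma ffunDE f g t : (f + g) t = f t + g t. Proof. by rewrite ffunE. Qed.
Lemma ffunNE f t : (- f) t = - f t. Proof. by rewrite ffunE. Qed.
Lemma ffunBE f g t : (f - g) t = f t - g t. Proof. by rewrite !ffunE. Qed.
Lemma ffunZE a f t : (a *: f) t = a *: f t. Proof. by rewrite ffunE. Qed.

Definition ffun_opE := (ffunBE, ffunDE, ffunNE, ffunZE).
End FfunOperations.

(** * The Koszul complex *)

Section Koszul.
Local Open Scope ring_scope.
Variables (K : fieldType) (n : nat).
Local Notation R := {mpoly K[n]}.
Implicit Types (S : {set 'I_n}) (t s : 'I_n) (m : 'X_{1..n}).

(** The sign of the basis vector [t] when it is moved to the front of the wedge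
product of [t] and [S] in increasing order. *)
Definition ksign t S : R := (-1) ^+ #|[set s in S | (s < t)%N]|.

Lemma ksign_card u t S : t \notin S ->
  #|[set s in t |: S | (s < u)%N]| = ((t < u)%N + #|[set s in S | (s < u)%N]|)%N.
Proof.
move=> tS; have [tu|ut] := ltnP t u.
  rewrite (cardsD1 t) !inE eqxx tu /=; congr addn.
  by apply: eq_card => s; rewrite !inE; case: eqP => [->|]; rewrite ?(negPf tS).
rewrite add0n; apply: eq_card => s; rewrite !inE; case: eqP => [->|//].
by rewrite ltnNge ut /= !andbF.
Qed.

Lemma ksign_add u t S : t \notin S ->
  ksign u (t |: S) = (-1) ^+ (t < u)%N * ksign u S.
Proof. by move=> tS; rewrite /ksign ksign_card // exprD. Qed.

Section Boundary.
Variable M : lmodType R.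
Implicit Type c : {ffun {set 'I_n} -> M}.

(** A chain [c] stands for the sum over [S] of [c S] times the wedge of the basis
vectors in [S]; all exterior degrees are kept together. *)
Definition kosz c : {ffun {set 'I_n} -> M} :=
  [ffun S : {set 'I_n} => \sum_(t | t \notin S) (ksign t S * 'X_t) *: c (t |: S)].

Lemma kosz_is_linear : linear kosz.
Proof.
move=> a c d; apply/ffunP => S; rewrite !ffunE scaler_sumr -big_split /=.
apply: eq_bigr => t _; rewrite !ffunE scalerDr !scalerA.
by congr (_ *: _ + _); rewrite mulrC.
Qed.

HB.instance Definition _ := GRing.isLinear.Build R
  {ffun {set 'I_n} -> M} {ffun {set 'I_n} -> M} _ kosz kosz_is_linear.

(** The terms that remove [t] and then [u], and [u] and then [t], carry the same
monomial and opposite signs. *)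
Lemma kosz_kosz c : kosz (kosz c) = 0.
Proof.
apply/ffunP => S; rewrite !ffunE.
pose a t u := ((ksign t S * 'X_t) * (ksign u (t |: S) * 'X_u)) *: c (u |: (t |: S)).
transitivity (\sum_(t | t \notin S) \sum_(u | u \notin t |: S) a t u).
  by apply: eq_bigr => t _; rewrite ffunE scaler_sumr; apply: eq_bigr => u _; rewrite scalerA.
rewrite pair_big_dep /= (bigID (fun p : 'I_n * 'I_n => (p.1 < p.2)%N)) /=.
rewrite [X in _ + X](reindex_inj (h := fun p : 'I_n * 'I_n => (p.2, p.1))) /=; last first.
  by move=> [? ?] [? ?] [-> ->].
set A := (X in X + _); set B := (X in _ + X).
suff -> : B = - A by rewrite subrr.
rewrite /A /B -sumrN; apply: eq_big => [[t u]|[t u]] /=.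
  rewrite !inE !negb_or -leqNgt [in RHS]ltn_neqAle -[_ == _ :> nat]/(t == u).
  by rewrite [u == t]eq_sym; case: (t == u); case: (t \in S); case: (u \in S).
rewrite !inE !negb_or -leqNgt => /andP[/andP[uS /andP[ntu tS]] letu].
have lttu : (t < u)%N by rewrite ltn_neqAle letu andbT.
rewrite /a !ksign_add // lttu ltnNge letu /= expr0 expr1 !mul1r mulN1r.
by rewrite setUCA -scaleNr; congr (_ *: _); ring.
Qed.

End Boundary.

Lemma kosz_map (M N : lmodType R) (f : {linear M -> N})
    (c : {ffun {set 'I_n} -> M}) :
  kosz [ffun S : {set 'I_n} => f (c S)] = [ffun S : {set 'I_n} => f (kosz c S)].
Proof.
apply/ffunP => S; rewrite !ffunE raddf_sum.
by apply: eq_bigr => t _; rewrite ffunE /= linearZ.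
Qed.

Lemma mcoeff_kosz (c : {ffun {set 'I_n} -> R^o}) S m :
  (kosz c S : R)@_m = \sum_(t | (t \notin S) && (0 < m t)%N)
     (-1) ^+ #|[set s in S | (s < t)%N]| * (c (t |: S) : R)@_(m - U_(t)).
Proof.
rewrite ffunE /= (raddf_sum (mcoeff m)) /= big_mkcondr; apply: eq_bigr => t _.
rewrite /GRing.scale /= -mulrA mcoeff_sign mcoeffXM lep1mP -lt0n.
by case: ifP => // _; rewrite mulr0.
Qed.

Lemma isform_kosz (c : {ffun {set 'I_n} -> R^o}) e S :
  (forall S, isform e (c S : R)) -> isform (1 + e) (kosz c S : R).
Proof.
move=> hc; rewrite ffunE; apply: isform_sum => t _.
rewrite /GRing.scale /= -mulrA; apply: isform_sign; apply: isformM => //.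
exact: isformX.
Qed.

(** The smallest variable occurring in the monomial [m] or in [S].  Moving it
between [m] and [S] matches the basis elements of the Koszul complex of R in pairs,
with the exception of the generator in degree 0; this matching replaces the Euler
homotopy, which needs characteristic 0. *)
Definition pivot m S t :=
  ((t \in S) || (0 < m t)%N) &&
  [forall s : 'I_n, (s < t)%N ==> ((s \notin S) && (m s == 0%N))].

Lemma pivot_uniq m S t u : pivot m S t -> pivot m S u -> t = u.
Proof.
move=> /andP[t1 /forallP t2] /andP[u1 /forallP u2]; apply/val_inj/eqP.
rewrite eqn_leq; apply/andP; split; rewrite leqNgt; apply/negP => lt.
  by have := t2 u; rewrite lt /= => /andP[/negPf uS /eqP mu]; move: u1; rewrite uS mu.
by have := u2 t; rewrite lt /= => /andP[/negPf uS /eqP mu]; move: t1; rewrite uS mu.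
Qed.

Lemma pick_pivot m S t : pivot m S t -> [pick t | pivot m S t] = Some t.
Proof.
move=> pt; case: pickP => [u pu|/(_ t)]; last by rewrite pt.
by congr Some; apply: pivot_uniq pt.
Qed.

Lemma pivot_exists m S : (m != 0%MM) || (S != set0) -> exists t, pivot m S t.
Proof.
move=> ne; pose P (t : 'I_n) := (t \in S) || (0 < m t)%N.
have [t0 Pt0] : exists t, P t.
  case/orP: ne => [m0|/set0Pn[t tS]]; last by exists t; rewrite /P tS.
  apply/existsP; apply: contraNT m0 => /existsPn nP; apply/eqP/mnmP => t.
  by have := nP t; rewrite /P negb_or -leqNgt leqn0 mnm0E => /andP[_ /eqP].
case: (@arg_minnP _ t0 P val Pt0) => t Pt tmin; exists t; rewrite /pivot -/(P t) Pt /=.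
apply/forallP => s; apply/implyP => lst.
have : ~~ P s by apply: contraL lst => /tmin; rewrite -leqNgt.
by rewrite /P negb_or -leqNgt leqn0.
Qed.

Lemma pivot_lt m S t s : pivot m S t -> s != t -> (0 < m s)%N -> (t < s)%N.
Proof.
move=> /andP[_ /forallP /(_ s)] + nst ms; case: ltnP => //= st.
  by move=> /andP[_ /eqP m0]; rewrite m0 in ms.
by move=> _; rewrite ltn_neqAle st andbT eq_sym.
Qed.

Lemma pivot_ksign m S S' t : pivot m S t -> S' \subset S ->
  (-1) ^+ #|[set s in S' | (s < t)%N]| = 1 :> K.
Proof.
move=> /andP[_ /forallP pt] sub; rewrite (_ : #|_| = 0%N) ?expr0 //.
apply/eqP; rewrite cards_eq0; apply/eqP/setP => s; rewrite !inE.
apply/negP => /andP[sS' st].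
by have := pt s; rewrite st (subsetP sub).
Qed.

(** The Koszul differential moves one variable between [m] and [S], hence leaves
the pivot unchanged. *)
Lemma pivot_step m S t s :
  pivot m S t -> (0 < m s)%N -> pivot (m - U_(s)) (s |: S) t.
Proof.
move=> pt ms; have [->|nst] := eqVneq s t.
  move: pt => /andP[_ /forallP pt]; rewrite /pivot !inE eqxx /=.
  apply/forallP => u; apply/implyP => ut; have := pt u; rewrite ut /= => /andP[uS mu].
  rewrite !inE negb_or uS mnmBE (eqP mu) sub0n eqxx !andbT.
  by apply: contraTneq ut => ->; rewrite ltnn.
have ts := pivot_lt pt nst ms.
move: pt => /andP[pt /forallP pt']; rewrite /pivot !inE mnmBE mnm1E (negPf nst) subn0.
rewrite -orbA pt orbT /=; apply/forallP => u; apply/implyP => ut.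
have := pt' u; rewrite ut /= => /andP[uS mu].
rewrite !inE negb_or uS mnmBE (eqP mu) sub0n eqxx !andbT.
by apply: contraTneq ut => ->; rewrite -leqNgt ltnW.
Qed.

(** The preimage is obtained from the contracting homotopy which moves the pivot
from the monomial into the set: its coefficient at [S] and [m] is that of [c] at
[S] without the pivot and [m] times the pivot when the pivot is in [S], and 0
otherwise.  Its vanishing at the empty set is what allows the lifting to be iterated
in a double complex. *)
Lemma koszul_exact (c : {ffun {set 'I_n} -> R^o}) e :
    kosz c = 0 -> (c set0 : R)@_0%MM = 0 ->
    (forall S, isform e (c S : R)) ->
  exists u : {ffun {set 'I_n} -> R^o},
    [/\ kosz u = c, u set0 = 0 & forall S, isform (e - 1) (u S : R)].
Proof.
move=> zc c0 hc.
pose E S m : K := if [pick t | pivot m S t] is Some t then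
  if t \in S then (c (S :\ t) : R)@_(m + U_(t)) else 0 else 0.
have hE S m : (mdeg m)%:Z != e - 1 -> E S m = 0.
  rewrite /E; case: pickP => // t _; case: ifP => // _ ne.
  apply: (isformE (hc _)); apply: contra ne => /eqP <-.
  by rewrite mdegD mdeg1 PoszD addrK.
have [u uE] : exists u : {ffun {set 'I_n} -> R^o}, forall S m, (u S : R)@_m = E S m.
  have : forall S, exists f : R, forall m, f@_m = E S m.
    move=> S; apply: (@mpoly_of_coeffs _ _ _ (absz e).+2) => m lem.
    by apply: hE; apply/eqP => me; lia.
  by move=> /fin_all_exists[f fE]; exists [ffun S : {set 'I_n} => f S] => S m; rewrite ffunE.
exists u; split.
- apply/ffunP => S; apply/mpolyP => m; rewrite mcoeff_kosz.
  have [/orP|] := boolP ((m != 0%MM) || (S != set0)); last first.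
    rewrite negb_or !negbK => /andP[/eqP-> /eqP->]; rewrite c0 big1 // => t.
    by rewrite mnm0E andbF.
  move=> /orP/pivot_exists[t pt].
  (* When the pivot is in S, the equation that c is a cycle, read at S without the
     pivot, expresses the coefficient of c through the other terms; when it is not,
     only the term of the pivot survives. *)
  have [tS|tS] := boolP (t \in S).
    have /(congr1 (fun f : R => f@_(m + U_(t)))) : (kosz c (S :\ t) : R) = 0.
      by rewrite zc ffunE.
    rewrite mcoeff0 mcoeff_kosz (bigD1 t) /=; last first.
      by rewrite !inE eqxx mnmDE mnm1E eqxx addn1.
    rewrite addmK setD1K // (pivot_ksign pt) ?mul1r; last by rewrite subD1set.
    move=> /eqP; rewrite addr_eq0 => /eqP ->.
    rewrite -sumrN; apply: eq_big => [s|s /andP[sS ms]].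
      rewrite !inE mnmDE mnm1E [t == s]eq_sym.
      case: eqVneq => [->|nst] /=; first by rewrite tS andbF.
      by rewrite addn0 andbT.
    have nst : s != t by apply/eqP => est; move: sS; rewrite est tS.
    have ts : (t < s)%N by apply: pivot_lt pt nst ms.
    have pst : pivot (m - U_(s)) (s |: S) t by exact: pivot_step.
    rewrite uE /E (pick_pivot pst) !inE tS orbT.
    have -> : (s |: S) :\ t = s |: (S :\ t).
      by apply/setP => v; rewrite !inE; case: (eqVneq v s) => [->|]; rewrite ?nst ?orbF.

    have -> : (m - U_(s) + U_(t) = m + U_(t) - U_(s))%MM.
      by rewrite addmC addmBA ?lep1mP -?lt0n // addmC.
    rewrite -mulNr; congr (_ * _).
    have tSt : t \notin S :\ t by rewrite !inE eqxx.
    have := ksign_card s tSt; rewrite setD1K // ts => ->.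
    by rewrite addnC addn1 exprS mulN1r.
  have mt : (0 < m t)%N by move: pt => /andP[]; rewrite (negPf tS).
  rewrite (bigD1 t) /=; last by rewrite tS.
  rewrite big1 => [|s /andP[/andP[sS ms] nst]]; last first.
    have pst : pivot (m - U_(s)) (s |: S) t.
      by apply: pivot_step => //; rewrite ?mnmBE.
    rewrite uE /E (pick_pivot pst) !inE eq_sym (negPf nst) (negPf tS).
    by rewrite mulr0.
  have pst : pivot (m - U_(t)) (t |: S) t by apply: pivot_step.
  rewrite addr0 uE /E (pick_pivot pst) !inE eqxx /= setU1K //.
  by rewrite submK ?lep1mP -?lt0n // (pivot_ksign pt) ?mul1r.
- apply/mpolyP => m; rewrite uE mcoeff0 /E; case: pickP => // t _.
  by rewrite in_set0.
- by move=> S; apply: isformP => m /hE; rewrite uE.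
Qed.

End Koszul.

(** * Vanishing of Koszul homology modulo monomial ideals *)

Section MonomialIdeals.
Local Open Scope ring_scope.
Variables (K : fieldType) (n : nat).
Local Notation R := {mpoly K[n]}.
Implicit Types (f g : R) (m : 'X_{1..n}) (U : pred 'X_{1..n}).

(** A monomial ideal is described by the predicate that its monomials satisfy; it is
an ideal when the predicate is [upclosed]. *)
Definition mideal U : set R := [set f | forall m, m \in msupp f -> U m]%classic.

Definition upclosed U := forall m d, U m -> U (d + m)%MM.

Lemma mideal0 U : mideal U 0. Proof. by move=> m; rewrite msupp0. Qed.

Lemma midealD U f g : mideal U f -> mideal U g -> mideal U (f + g).
Proof.
move=> hf hg m /msuppD_le; rewrite mem_cat => /orP[]; [exact: hf|exact: hg].
Qed.

Lemma midealN U f : mideal U f -> mideal U (- f).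
Proof. by move=> hf m; rewrite (perm_mem (msuppN f)); exact: hf. Qed.

Lemma midealB U f g : mideal U f -> mideal U g -> mideal U (f - g).
Proof. by move=> hf hg; apply: midealD => //; apply: midealN. Qed.

Lemma midealM U f g : upclosed U -> mideal U g -> mideal U (f * g).
Proof.
move=> upU hg m /msuppM_le /allpairsP[[m1 m2] /= [_ m2g ->]].
by apply: upU; apply: hg.
Qed.

Lemma mideal_sum U (T : Type) (s : seq T) (P : pred T) (F : T -> R) :
  (forall t, P t -> mideal U (F t)) -> mideal U (\sum_(t <- s | P t) F t).
Proof. by move=> hF; elim/big_ind: _ => //; [exact: mideal0 | exact: midealD]. Qed.

Lemma midealXM U k f :
  mideal U ('X_[k] * f) <-> mideal (fun m => U (m + k)%MM) f.
Proof.
rewrite mulrC; split=> h m.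
  rewrite mcoeff_msupp => fm; apply: h.
  by rewrite mcoeff_msupp addmC mcoeffMX.
by rewrite (perm_mem (msuppMX f k)) => /mapP[m' m'f ->]; rewrite addmC; apply: h.
Qed.

Lemma mideal_kosz U (c : {ffun {set 'I_n} -> R^o}) S :
  upclosed U -> (forall S, mideal U (c S)) -> mideal U (kosz c S).
Proof.
move=> upU hc; rewrite ffunE; apply: mideal_sum => t _.
by rewrite /GRing.scale /=; apply: midealM.
Qed.

(** Monomials outside [U] are divisible by [x], so they are collected in the second
term.  The splitting is by monomials, so it respects degrees. *)
Lemma mideal_split U x f :
    mideal (fun m => U m || (0 < m x)%N) f ->
  exists p : R * R, [/\ f = p.1 + 'X_x * p.2, mideal U p.1 &
    forall e, isform e f -> isform (e - 1) p.2].
Proof.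
move=> hf.
have bnd m : (msize f <= mdeg m)%N -> f@_m = 0.
  by move=> le; apply: memN_msupp_eq0; apply: msize_mdeg_ge.
have [m|a aE] := @mpoly_of_coeffs K n (fun m => if U m then f@_m else 0) (msize f).
  by move=> /bnd ->; case: ifP.
have [m|g gE] := @mpoly_of_coeffs K n
    (fun m => if U (m + U_(x))%MM then 0 else f@_(m + U_(x))) (msize f).
  by move=> le; case: ifP => // _; apply: bnd; rewrite mdegD (leq_trans le) // leq_addr.
exists (a, g); split => /=.
- apply/mpolyP => m; rewrite mcoeffD aE mcoeffXM gE lep1mP -lt0n.
  have [m0|m0] := posnP (m x).
    rewrite addr0; case: ifP => // nUm; apply: memN_msupp_eq0.
    by apply/negP => /hf; rewrite nUm m0.
  rewrite submK ?lep1mP -?lt0n //; case: ifP; rewrite ?addr0 ?add0r //.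
- by move=> m; rewrite mcoeff_msupp aE; case: ifP => //; rewrite eqxx.
- move=> e fe; apply: isformP => m ne; rewrite gE; case: ifP => // _.
  by apply: (isformE fe); rewrite mdegD mdeg1; lia.
Qed.

(** The homology of the Koszul complex of R/I in coefficient degree [e] is zero.
The boundary is asked to come from a chain of forms of degree [e - 1], which saves
taking homogeneous components later. *)
Definition kvanish (I : set R) (e : int) :=
  forall c : {ffun {set 'I_n} -> R^o},
    (forall S, isform e (c S : R)) -> (forall S, I (kosz c S)) ->
  exists y : {ffun {set 'I_n} -> R^o},
    (forall S, isform (e - 1) (y S : R)) /\ (forall S, I (c S - kosz y S : R)).

Let chain := {ffun {set 'I_n} -> R^o}.

Lemma chain_split U x (c : chain) e :
    (forall S, mideal (fun m => U m || (0 < m x)%N) (c S)) ->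
    (forall S, isform e (c S : R)) ->
  exists a g : chain, [/\ c = a + 'X_x *: g, forall S, mideal U (a S) &
     forall S, isform (e - 1) (g S : R)].
Proof.
move=> hc ce; have /fin_all_exists[p pP] := fun S => mideal_split (hc S).
exists [ffun S => (p S).1], [ffun S => (p S).2]; split.
- by apply/ffunP => S; rewrite !ffunE; have [] := pP S.
- by move=> S; rewrite ffunE; have [] := pP S.
- by move=> S; rewrite ffunE; have [_ _] := pP S; apply.
Qed.

Lemma isform_Xscale e (i : 'I_n) f : isform (e - 1) f -> isform e ('X_i * f).
Proof. by move=> fe; rewrite -[e](subrK 1) addrC; apply: isformM => //; apply: isformX. Qed.

(** Middle exactness of the homology sequence of
0 -> R/(I : x)(-1) -> R/I -> R/(I + (x)) -> 0: a cycle modulo I is a boundary modulo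
I + (x), up to x times a chain that is a cycle modulo I : x. *)
Lemma kvanish_add_colon U x e : upclosed U ->
    kvanish (mideal (fun m => U m || (0 < m x)%N)) e ->
    kvanish (mideal (fun m => U (m + U_(x))%MM)) (e - 1) ->
  kvanish (mideal U) e.
Proof.
move=> upU v1 v2 c ce cU.
have [|y [ye yU]] := v1 c ce; first by move=> S m /cU ->.
have [||a [g [cE aU ge]]] := @chain_split U x (c - kosz y) e.
- by move=> S; rewrite ffun_opE; exact: yU.
- move=> S; rewrite !ffun_opE; apply: isformB => //.
  by rewrite -[e](subrK 1) addrC; exact: isform_kosz.
have gU S : mideal (fun m => U (m + U_(x))%MM) (kosz g S).
  apply/midealXM.
  have -> : 'X_x * kosz g S = kosz c S - kosz a S :> R.
    have /(congr1 (fun c => kosz c S)) := cE.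
    by rewrite linearB linearD linearZ /= kosz_kosz subr0 => ->; rewrite !ffun_opE addrC addKr.
  by apply: midealB => //; apply: mideal_kosz.
have [z [ze zU]] := v2 g ge gU.
exists (y + 'X_x *: z); split=> S.
  by rewrite !ffun_opE; apply: isformD => //; exact: isform_Xscale.
have -> : c S - kosz (y + 'X_x *: z) S = a S + 'X_x * (g S - kosz z S) :> R.
  rewrite linearD linearZ /= -[c](subrK (kosz y)) cE !ffun_opE /GRing.scale /=; ring.
by apply: midealD => //; apply/midealXM.
Qed.

(** The homology sequence of 0 -> R/I(-1) -> R/I -> R/(I + (x)) -> 0.  The boundary of
a cycle modulo I + (x) is, modulo I, x times a chain [g] of the same coefficient degree
[e], and [g] is a cycle modulo I since x is a nonzerodivisor; this is why the same
degree suffices in hypothesis and conclusion. *)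
Lemma kvanish_addvar U x e : upclosed U ->
    (forall m, U (m + U_(x))%MM -> U m) ->
    kvanish (mideal U) e ->
  kvanish (mideal (fun m => U m || (0 < m x)%N)) e.
Proof.
move=> upU nzd v c ce cU.
have [||a [g [cE aU ge]]] := @chain_split U x (kosz c) (1 + e).
- exact: cU.
- by move=> S; exact: isform_kosz.
have gU S : mideal U (kosz g S).
  suff : mideal (fun m => U (m + U_(x))%MM) (kosz g S) by move=> h m /h /nzd.
  apply/midealXM.
  have -> : 'X_x * kosz g S = - kosz a S :> R.
    have /(congr1 (fun c => kosz c S)) := cE.
    rewrite kosz_kosz linearD linearZ /= => /eqP.
    by rewrite eq_sym !ffun_opE [X in _ == X]ffunE addrC addr_eq0 => /eqP.
  by apply: midealN; apply: mideal_kosz.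
have e1 : 1 + e - 1 = e by rewrite addrC addKr.
rewrite e1 in ge.
have [z [ze zU]] := v g ge gU.
have [||y [ye yU]] := v (c - 'X_x *: z).
- by move=> S; rewrite !ffun_opE; apply: isformB => //; apply: isform_Xscale.
- move=> S; rewrite linearB linearZ /= cE !ffun_opE /=.
  rewrite -addrA -scalerBr; apply: midealD => //; apply: midealM => //; exact: zU.
exists y; split=> // S m; rewrite -[c S - _](subrK ('X_x * z S)) => /msuppD_le.
rewrite mem_cat => /orP[mem|].
  by rewrite (yU S) // !ffun_opE addrAC.
rewrite mulrC (perm_mem (msuppMX _ _)) => /mapP[k _ ->].
by rewrite mnmDE mnm1E eqxx orbT.
Qed.

(** Only constants on the empty set survive in the homology of R, and their
coefficient degree is 0. *)
Lemma kvanish0 e : e != 0 -> kvanish (mideal xpred0) e.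
Proof.
move=> e0 c ce c0.
have [|||y [<- _ ye]] := @koszul_exact K n c e.
- apply/ffunP => S; rewrite [RHS]ffunE; apply: msuppnil0.
  have : forall m, m \in msupp (kosz c S : R) -> false := c0 S.
  by case: msupp => // m s /(_ m); rewrite inE eqxx => /(_ isT).
- by apply: (isformE (ce _)); rewrite mdeg0 eq_sym.
- exact: ce.
exists y; split=> // S; rewrite subrr; exact: mideal0.
Qed.

End MonomialIdeals.

(** * From Tor to Koszul homology *)

Section Balancing.
Local Open Scope ring_scope.
Variables (K : fieldType) (n : nat).
Local Notation R := {mpoly K[n]}.
Implicit Types (f g : R) (m : 'X_{1..n}) (U : pred 'X_{1..n}).

Lemma kosz_coord k (c : {ffun {set 'I_n} -> 'rV[R]_k}) l S :
  kosz ([ffun S : {set 'I_n} => c S 0 l] : {ffun _ -> R^o}) S = kosz c S 0 l.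
Proof.
rewrite !ffunE summxE; apply: eq_bigr => t _.
by rewrite ffunE mxE.
Qed.

Lemma koszul_exact_rV k (c : {ffun {set 'I_n} -> 'rV[R]_k}) (g : 'I_k -> int) :
    kosz c = 0 -> (forall l, (c set0 0 l)@_0%MM = 0) ->
    (forall S l, isform (g l) (c S 0 l)) ->
  exists u : {ffun {set 'I_n} -> 'rV[R]_k},
    [/\ kosz u = c, u set0 = 0 & forall S l, isform (g l - 1) (u S 0 l)].
Proof.
move=> zc c0 hc.
have /fin_all_exists[u uP] l :
    exists u : {ffun {set 'I_n} -> R^o},
    [/\ kosz u = [ffun S : {set 'I_n} => c S 0 l],
        u set0 = 0 & forall S, isform (g l - 1) (u S : R)].
  apply: koszul_exact; last by move=> S; rewrite ffunE; exact: hc.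
    by apply/ffunP => S; rewrite kosz_coord zc !ffunE mxE.
  by rewrite ffunE; exact: c0.
exists [ffun S : {set 'I_n} => \row_l u l S]; split.
- apply/ffunP => S; apply/rowP => l; rewrite -kosz_coord.
  have [ul _ _] := uP l; move/ffunP/(_ S): ul.
  rewrite [in RHS]ffunE => <-; rewrite [X in kosz X](_ : _ = u l) //.
  by apply/ffunP => S'; rewrite !ffunE mxE.
- by apply/rowP => l; rewrite ffunE !mxE; have [] := uP l.
- by move=> S l; rewrite ffunE mxE; have [_ _] := uP l; apply.
Qed.

Definition chain_mulmx k l (D : 'M[R]_(k, l)) (c : {ffun {set 'I_n} -> 'rV[R]_k}) :
  {ffun {set 'I_n} -> 'rV[R]_l} := [ffun S : {set 'I_n} => c S *m D].

Lemma kosz_mulmx k l (D : 'M[R]_(k, l)) c :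
  kosz (chain_mulmx D c) = chain_mulmx D (kosz c).
Proof. exact: (kosz_map (mulmxr D)). Qed.

Section Resolution.
Variables (U : pred 'X_{1..n}) (F : graded_free_resolution (mideal U : set R)).
Hypothesis upU : upclosed U.

Lemma res_d_form i k l : isform (res_deg k - res_deg l) (res_d F i k l).
Proof. by move=> m /res_d_homog ->; rewrite addrC addKr. Qed.

Lemma mulmx_form i (w : 'rV[R]_(res_rank F i.+1)) (g : int) :
    (forall k, isform (g - res_deg k) (w 0 k)) ->
  forall l, isform (g - res_deg l) ((w *m res_d F i) 0 l).
Proof.
move=> hw l; rewrite mxE; apply: isform_sum => k _.
rewrite (_ : g - _ = (g - res_deg k) + (res_deg k - res_deg l)); last by ring.
by apply: isformM => //; exact: res_d_form.
Qed.

Lemma res_dd i (w : 'rV[R]_(res_rank F i.+2)) : w *m res_d F i.+1 *m res_d F i = 0.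
Proof. by apply/res_exact; exists w. Qed.

(** The condition on an element of the double complex, at homological position [i],
under which the zigzag towards position 0 can be started. *)
Definition liftable i : {ffun {set 'I_n} -> 'rV[R]_(res_rank F i)} -> Prop :=
  match i with
  | 0%N => fun w => forall S, mideal U ((kosz w S *m res_aug F) 0 0)
  | i'.+1 => fun w => kosz (chain_mulmx (res_d F i') w) = 0 /\
      forall l, (chain_mulmx (res_d F i') w set0 0 l)@_0%MM = 0
  end.

(** One descends along the resolution: if the image of [w] under the differential of the
resolution is a Koszul cycle, it is the Koszul boundary of some [u], and the lemma for
[u] one position lower gives the decomposition for [w].  The coefficient degree drops
with the position, so [g - i] does not change; at position 0 the augmentation turns
[w] into a Koszul cycle modulo the ideal, of degree [g], where the vanishing
hypothesis applies. *)
Lemma lift_chain i (w : {ffun {set 'I_n} -> 'rV[R]_(res_rank F i)}) (g : int) :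
    (forall S k, isform (g - res_deg k) (w S 0 k)) -> liftable w ->
    kvanish (mideal U : set R) (g - i%:Z) ->
  exists Y Z, w = kosz Y + chain_mulmx (res_d F i) Z.
Proof.
elim: i w g => [|i IHi] w g wg.
  move=> wU; rewrite subr0 => v.
  have augL (c : {ffun {set 'I_n} -> 'rV[R]_(res_rank F 0)}) S :
      (kosz c S *m res_aug F) 0 0 =
      kosz ([ffun S => (c S *m res_aug F) 0 0] : {ffun {set 'I_n} -> R^o}) S.
    have -> : [ffun S => (c S *m res_aug F) 0 0] =
        [ffun S : {set 'I_n} => chain_mulmx (res_aug F) c S 0 0] :> {ffun {set 'I_n} -> R^o}.
      by apply/ffunP => S'; rewrite !ffunE.
    by rewrite kosz_coord kosz_mulmx [in RHS]ffunE.
  have [||y [_ yU]] := v [ffun S : {set 'I_n} => (w S *m res_aug F) 0 0].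
  - move=> S; rewrite ffunE mxE; apply: isform_sum => k _.
    rewrite -[g](subrK (res_deg k)); apply: isformM => //.
    by move=> m /res_aug_homog ->.
  - by move=> S; rewrite -augL; exact: wU.
  have [v0 v0U] := res_surj F.
  pose Y : {ffun {set 'I_n} -> 'rV[R]_(res_rank F 0)} := [ffun S : {set 'I_n} => (y S : R) *: v0].
  have YU S : mideal U (((w - kosz Y) S *m res_aug F) 0 0).
    rewrite ffun_opE mulmxBl mxE [X in _ + X]mxE augL.
    have -> : [ffun S => (Y S *m res_aug F) 0 0] =
        y + [ffun S : {set 'I_n} => ((v0 *m res_aug F) 0 0 - 1) * y S]
        :> {ffun {set 'I_n} -> R^o}.
      by apply/ffunP => S'; rewrite ffun_opE !ffunE -scalemxAl mxE; ring.
    rewrite linearD ffun_opE opprD addrA; apply: midealB.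
      by have := yU S; rewrite ffunE.
    apply: mideal_kosz => // S'; rewrite ffunE mulrC; exact: midealM.
  have /fin_all_exists[Z ZP] : forall S, exists z, (w - kosz Y) S = z *m res_d F 0.
    by move=> S; apply/res_exact0.
  exists Y, [ffun S => Z S]; rewrite -[LHS](subrK (kosz Y)) addrC; congr (_ + _).
  by apply/ffunP => S; rewrite ZP !ffunE.
move=> [zdw dw0] v.
have [|u [uE u0 ug]] := koszul_exact_rV zdw dw0 (g := fun l => g - res_deg l).
  by move=> S l; rewrite ffunE; apply: mulmx_form.
have [|||Y [Z uYZ]] := IHi u (g - 1).
- by move=> S k; rewrite addrAC; exact: ug.
- case: i {IHi v} w wg zdw dw0 u uE u0 ug => [|i] w wg zdw dw0 u uE u0 ug /=.
    move=> S; rewrite uE ffunE; apply/res_exact0; by exists (w S).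
  split; first by rewrite kosz_mulmx uE; apply/ffunP => S; rewrite !ffunE res_dd.
  by move=> l; rewrite ffunE u0 mul0mx mxE mcoeff0.
- by rewrite (_ : _ - _ = g - i.+1%:Z) //; lia.
have ZE S : (w - kosz Z) S *m res_d F i = 0.
  have /(congr1 (fun c => kosz c S)) := uYZ.
  rewrite uE linearD /= kosz_kosz add0r kosz_mulmx !ffunE => E.
  by rewrite mulmxBl E subrr.
have /fin_all_exists[Z' Z'P] : forall S, exists z, (w - kosz Z) S = z *m res_d F i.+1.
  by move=> S; apply/res_exact; exact: ZE.
exists Z, [ffun S => Z' S]; rewrite -[LHS](subrK (kosz Z)) addrC; congr (_ + _).
by apply/ffunP => S; rewrite Z'P !ffunE.
Qed.

End Resolution.

(** Lift the cycle to constants placed on the empty set and decompose it by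
[lift_chain].  On the empty set the Koszul boundary has no constant term, so modulo the
variables only the boundary of the resolution is left. *)
Lemma tor_neq0_kvanish U i (j : int) : upclosed U ->
  tor_neq0 (mideal U : set R) i j -> ~ kvanish (mideal U : set R) (j - i%:Z).
Proof.
move=> upU [F [v [vj vcyc vnb]]] van; apply: vnb.
pose w0 : {ffun {set 'I_n} -> 'rV[R]_(res_rank F i)} :=
  [ffun S : {set 'I_n} => if S == set0 then map_mx (@mpolyC n K) v else 0].
have w0f S k : isform (j - res_deg k) (w0 S 0 k).
  rewrite ffunE; case: eqP => _; rewrite mxE; last exact: isform0.
  move=> m; rewrite mcoeff_msupp mcoeffC mulf_eq0 negb_or => /andP[/vj -> ].
  by rewrite subrr; case: (m =P 0%MM) => [-> _|_]; rewrite ?mdeg0 ?eqxx.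
have w0z : kosz w0 = 0.
  apply/ffunP => S; rewrite ffunE [RHS]ffunE big1 // => t _.
  rewrite ffunE; case: eqP => [E|_]; last by rewrite scaler0.
  by have := setU11 t S; rewrite E inE.
have w0E : w0 set0 = map_mx (@mpolyC n K) v by rewrite ffunE eqxx.
have w0l : liftable w0.
  case: i F v vj vcyc w0 w0f w0z w0E {van} => [|i] F v vj vcyc w0 w0f w0z w0E /=.
    by move=> S; rewrite w0z ffunE mul0mx mxE; exact: mideal0.
  split.
    by rewrite kosz_mulmx w0z; apply/ffunP => S; rewrite !ffunE mul0mx.
  move=> l; rewrite ffunE w0E; move: vcyc => /= /rowP/(_ l).
  rewrite !mxE => <-; rewrite raddf_sum; apply: eq_bigr => k _ /=.
  by rewrite rmorphM /= !mxE mpolyCK.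
have [Y [Z /ffunP/(_ set0)]] := lift_chain upU w0f w0l van.
rewrite w0E ffun_opE !ffunE => E.
pose z := map_mx (mcoeff 0%MM) (Z set0) : 'rV[K]_(res_rank F i.+1).
have vE : v = z *m res_dK F i.
  apply/rowP => l; have /rowP/(_ l)/(congr1 (mcoeff 0%MM)) := E.
  rewrite !mxE mpolyCK => ->; rewrite mcoeffD summxE !raddf_sum /= big1 ?add0r => [|t _].
    by apply: eq_bigr => k _; rewrite rmorphM /= !mxE.
  rewrite mxE rmorphM rmorphM /= mcoeffX; case: eqP => [/eqP|_]; last by rewrite mulr0 mul0r.
  by rewrite mnm1_eq0.
have dKdeg k l : res_dK F i k l != 0 -> res_deg k = res_deg l.
  by rewrite mxE -mcoeff_msupp => /res_d_homog ->; rewrite mdeg0 addr0.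
(* The differential modulo the variables preserves degrees, so other degrees of the
   preimage can be discarded. *)
exists (\row_k (if res_deg k == j then z 0 k else 0) : 'rV[K]_(res_rank F i.+1)); split.
  by move=> k; rewrite mxE; case: ifP => [/eqP //|]; rewrite eqxx.
apply/rowP => l; rewrite [in RHS]mxE.
have [lj|lj] := eqVneq (res_deg l) j.
  rewrite vE mxE; apply: eq_bigr => k _; rewrite [in RHS]mxE.
  have [//|kj] := eqVneq (res_deg k) j.
  have [->|/dKdeg kl] := eqVneq (res_dK F i k l) 0; first by rewrite !mulr0.
  by rewrite kl lj eqxx in kj.
rewrite big1 => [|k _]; first by apply/eqP; apply: contraNT lj => /vj ->.
rewrite mxE; have [kj|kj] := eqVneq (res_deg k) j; last by rewrite mul0r.
have [->|/dKdeg kl] := eqVneq (res_dK F i k l) 0; first by rewrite !mulr0.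
by rewrite -kl kj eqxx in lj.
Qed.

End Balancing.

(** * The simplicial resolution of a monomial ideal *)

(** The free module in position [i] has one generator for each [i]-tuple of monomial
generators, repetitions included, in the multidegree of their least common multiple.
In a fixed multidegree [b] one finds the ordered chain complex of the full simplex on
the generators dividing [b], which is contractible as soon as one generator divides
[b]. *)
Section SimplicialResolution.
Local Open Scope ring_scope.
Variables (K : fieldType) (n : nat).
Local Notation R := {mpoly K[n]}.
Variables (V : finType) (g : V -> 'X_{1..n}).
Implicit Types (m b : 'X_{1..n}) (s t r : seq V).

Definition gen_by : pred 'X_{1..n} := fun m => [exists v, (g v <= m)%MM].

Definition lcms s : 'X_{1..n} := foldr (fun v m => mlcm (g v) m) 0%MM s.

Lemma lem_lcms s m : (lcms s <= m)%MM = all (fun v => (g v <= m)%MM) s.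
Proof.
elim: s => [|v s IHs] /=; last by rewrite lem_mlcm IHs.
by apply/mnm_lepP => i; rewrite mnm0E.
Qed.

(** The coefficient of [t] in the alternating sum of the faces of [s], computed by
removing the first entry of [s], or keeping it and taking a face of the rest with the
opposite sign. *)
Fixpoint face_coef s t : K :=
  if s is v :: s' then
    (s' == t)%:R - (if t is u :: t' then (u == v)%:R * face_coef s' t' else 0)
  else 0.

Lemma face_coef_neq0_sub s t : face_coef s t != 0 -> {subset t <= s}.
Proof.
elim: s t => [|v s IHs] t /=; first by rewrite eqxx.
have [<- _|_] := eqVneq s t; first by move=> x xs; rewrite inE xs orbT.
rewrite add0r oppr_eq0; case: t => [|u t]; first by rewrite eqxx.
have [->|_] := eqVneq u v; last by rewrite mul0r eqxx.
rewrite mul1r => /IHs sub x; rewrite !inE => /orP[->//|/sub ->].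
by rewrite orbT.
Qed.

Lemma face_coef_neq0_lcms s t : face_coef s t != 0 -> (lcms t <= lcms s)%MM.
Proof.
move=> /face_coef_neq0_sub sub; rewrite lem_lcms; apply/allP => v /sub vs.
by have := lepm_refl (lcms s); rewrite {1}lem_lcms => /allP; apply.
Qed.

Lemma sum_tupleS i (F : i.+1.-tuple V -> K) :
  \sum_(t : i.+1.-tuple V) F t = \sum_v \sum_(t : i.-tuple V) F (cons_tuple v t).
Proof.
rewrite pair_big /= (reindex (fun p : V * i.-tuple V => cons_tuple p.1 p.2)) //=.
exists (fun t : i.+1.-tuple V => (thead t, behead_tuple t)) => [[v t] _|t _] /=.
  by congr pair; rewrite ?theadE //; apply: val_inj.
by rewrite [RHS]tuple_eta; apply: val_inj.
Qed.

Lemma sum_tuple_eq i s (F : seq V -> K) : size s = i ->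
  \sum_(t : i.-tuple V) (s == t)%:R * F t = F s.
Proof.
move=> /eqP si; rewrite (bigD1 (Tuple si)) //= eqxx mul1r big1 ?addr0 // => t.
by rewrite -val_eqE /= eq_sym => /negPf ->; rewrite mul0r.
Qed.

Lemma face_coef_cons_sum i v (c : i.-tuple V -> K) r :
  \sum_(t : i.-tuple V) c t * face_coef (v :: t) r =
  (\sum_(t : i.-tuple V) (r == t)%:R * c t) -
  (if r is x :: r' then (x == v)%:R * \sum_(t : i.-tuple V) c t * face_coef t r' else 0).
Proof.
transitivity (\sum_(t : i.-tuple V) ((r == t)%:R * c t -
    (if r is x :: r' then (x == v)%:R * (c t * face_coef t r') else 0))).
  apply: eq_bigr => t _ /=; rewrite mulrBr mulrC [tval t == r]eq_sym.
  by case: r => [|x r]; rewrite ?mulr0 // mulrCA.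
rewrite sumrB; congr (_ - _).
by case: r => [|x r]; [rewrite big1 | rewrite mulr_sumr].
Qed.

Lemma face_coef_cons_face i v s r : size s = i.+1 ->
  \sum_(t : i.+1.-tuple V) face_coef (v :: s) t * face_coef t r =
  face_coef s r - \sum_(t : i.-tuple V) face_coef s t * face_coef (v :: t) r.
Proof.
move=> ss; rewrite sum_tupleS.
transitivity (\sum_x \sum_(t : i.-tuple V)
    ((s == x :: t)%:R * face_coef (x :: t) r -
     (x == v)%:R * (face_coef s t * face_coef (x :: t) r))).
  by apply: eq_bigr => x _; apply: eq_bigr => t _ /=; rewrite mulrBl -mulrA.
under eq_bigr do rewrite sumrB; rewrite sumrB.
rewrite -(sum_tupleS (fun t : i.+1.-tuple V => (s == t)%:R * face_coef t r)).
rewrite (sum_tuple_eq (fun t => face_coef t r)) //.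
congr (_ - _); rewrite (bigD1 v) //= [X in _ + X]big1 ?addr0; last first.
  by move=> x /negPf xv; rewrite big1 // => t _; rewrite xv mul0r.
by apply: eq_bigr => t _; rewrite eqxx mul1r.
Qed.

(** The alternating sum of faces is a differential: by [face_coef_cons_face] and
[face_coef_cons_sum] the first entry of [s] contributes the faces of the rest twice, with
opposite signs. *)
Lemma face_coef_face i s r : size s = i.+2 -> size r = i ->
  \sum_(t : i.+1.-tuple V) face_coef s t * face_coef t r = 0.
Proof.
elim: i s r => [|i IHi] [//|v s] r [ss] sr.
all: rewrite face_coef_cons_face // face_coef_cons_sum (sum_tuple_eq (fun t => face_coef s t)) //.
  by case: r sr => // _; rewrite subr0 subrr.
case: r sr => // x r [sr]; rewrite IHi //.
by rewrite mulr0 subr0 subrr.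
Qed.

Definition tuple_rank i := #|{: i.-tuple V}|.

Definition tuple_val i (a : 'I_(tuple_rank i)) : i.-tuple V := enum_val a.

Definition tuple_mx i : 'M[R]_(tuple_rank i.+1, tuple_rank i) :=
  \matrix_(a, c) (face_coef (tuple_val a) (tuple_val c) *:
                  'X_[lcms (tuple_val a) - lcms (tuple_val c)]).

(** The component of [v] in multidegree [b], as a chain of tuples over the field. *)
Definition strand b i (v : 'rV[R]_(tuple_rank i)) (t : i.-tuple V) : K :=
  if (lcms t <= b)%MM then (v 0 (enum_rank t))@_(b - lcms t) else 0.

(** In each multidegree the differential becomes the differential of simplicial
chains, without monomials. *)
Lemma strand_mulmx b i (v : 'rV[R]_(tuple_rank i.+1)) (t : i.-tuple V) :
  strand b (v *m tuple_mx i) t = \sum_(s : i.+1.-tuple V) strand b v s * face_coef s t.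
Proof.
rewrite /strand mxE raddf_sum (reindex (@enum_rank _)) /=; last first.
  exact/onW_bij/enum_rank_bij.
have E (s : i.+1.-tuple V) : face_coef s t != 0 -> (lcms t <= lcms s)%MM.
  exact: face_coef_neq0_lcms.
case: ifPn => [tb|tb]; last first.
  rewrite big1 // => s _; case: ifP => sb; last by rewrite mul0r.
  have [->|/E ts] := eqVneq (face_coef s t) 0; first by rewrite mulr0.
  by rewrite (lepm_trans ts sb) in tb.
apply: eq_bigr => s _; rewrite mxE /tuple_val !enum_rankK -scalerAr mcoeffZ mulrC.
have [->|/E ts] := eqVneq (face_coef s t) 0; first by rewrite !mulr0.
congr (_ * _); rewrite [_ * 'X_[_]]mulrC mcoeffXM.
have -> : (lcms s - lcms t <= b - lcms t)%MM = (lcms s <= b)%MM.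
  apply/mnm_lepP/mnm_lepP => le x; have := le x; rewrite ?mnmBE;
    move/mnm_lepP/(_ x): ts; move/mnm_lepP/(_ x): tb; lia.
case: ifP => // /mnm_lepP sb; congr (_@__); apply/mnmP => x; rewrite !mnmBE.
move/mnm_lepP/(_ x): ts; move/mnm_lepP/(_ x): tb; have := sb x; lia.
Qed.

Lemma strand_inj i (v w : 'rV[R]_(tuple_rank i)) :
  (forall b (t : i.-tuple V), strand b v t = strand b w t) -> v = w.
Proof.
move=> E; apply/rowP => a; apply/mpolyP => m.
have := E (m + lcms (tuple_val a))%MM (tuple_val a).
by rewrite /strand lem_addl /tuple_val enum_valK addmK.
Qed.

Lemma strand0 b i (t : i.-tuple V) : strand b (0 : 'rV_(tuple_rank i)) t = 0.
Proof. by rewrite /strand mxE mcoeff0; case: ifP. Qed.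

Lemma strand_bounded i (v : 'rV[R]_(tuple_rank i)) :
  exists B, forall b (t : i.-tuple V), (B <= mdeg b)%N -> strand b v t = 0.
Proof.
exists (\max_(t : i.-tuple V) (msize (v 0%R (enum_rank t)) + mdeg (lcms t)))%N => b t leB.
rewrite /strand; case: ifP => // tb; apply: memN_msupp_eq0; apply: msize_mdeg_ge.
rewrite -(leq_add2r (mdeg (lcms t))) -mdegD submK //.
exact: leq_trans (leq_bigmax (F := fun t : i.-tuple V =>
  (msize (v 0%R (enum_rank t)) + mdeg (lcms t))%N) t) leB.
Qed.

Lemma strand_exists i (c : 'X_{1..n} -> i.-tuple V -> K) B :
    (forall b (t : i.-tuple V), (B <= mdeg b)%N -> c b t = 0) ->
    (forall b (t : i.-tuple V), c b t != 0 -> (lcms t <= b)%MM) ->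
  exists w : 'rV[R]_(tuple_rank i), forall b (t : i.-tuple V), strand b w t = c b t.
Proof.
move=> cB cl.
have /fin_all_exists[w wE] : forall a : 'I_(tuple_rank i), exists f : R,
    forall m, f@_m = c (m + lcms (tuple_val a))%MM (tuple_val a).
  move=> a; apply: (@mpoly_of_coeffs _ _ _ B) => m Bm; apply: cB.
  by rewrite mdegD (leq_trans Bm) // leq_addr.
exists (\row_a w a) => b t; rewrite /strand mxE wE /tuple_val enum_rankK.
case: ifPn => [tb|tb]; first by rewrite submK.
by apply/esym/eqP; apply: contraNT tb => /cl.
Qed.

Lemma tuple_mx_mul i (w : 'rV[R]_(tuple_rank i.+2)) :
  w *m tuple_mx i.+1 *m tuple_mx i = 0.
Proof.
apply: strand_inj => b t; rewrite strand0 strand_mulmx.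
under eq_bigr do rewrite strand_mulmx mulr_suml.
rewrite exchange_big big1 // => s _ /=.
under eq_bigr do rewrite -mulrA.
by rewrite -mulr_sumr face_coef_face ?mulr0 ?size_tuple.
Qed.

(** The contraction in multidegree [b] puts in front of every tuple one fixed generator
[v0 b] dividing [b].  The hypothesis on [gen_by] provides this generator, and the case
[i = 0] is the exactness at the augmentation, where no cycle condition is imposed. *)
Lemma tuple_mx_exact i (v : 'rV[R]_(tuple_rank i)) :
    (forall b (t : i.-tuple V), strand b v t != 0 -> gen_by b) ->
    (if i is i'.+1 then forall b (r : i'.-tuple V),
        \sum_(t : i.-tuple V) strand b v t * face_coef t r = 0 else True) ->
  exists w, v = w *m tuple_mx i.
Proof.
move=> vU vz; pose v0 b := [pick u | (g u <= b)%MM].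
pose c b (t : i.+1.-tuple V) :=
  if v0 b == Some (thead t) then strand b v (behead_tuple t) else 0.
have [B vB] := strand_bounded v.
have [||w wE] := @strand_exists i.+1 c B.
- by move=> b t /vB E; rewrite /c E; case: ifP.
- move=> b t; rewrite /c /v0; case: pickP => [u ub|_]; last by rewrite eqxx.
  have [[ut]|_] := eqVneq (Some u) (Some (thead t)); last by rewrite eqxx.
  rewrite /strand; case: ifP => [tb _|]; last by rewrite eqxx.
  by rewrite lem_lcms (tuple_eta t) /= -ut ub; rewrite lem_lcms in tb.
exists w; apply: strand_inj => b s; rewrite strand_mulmx.
under eq_bigr do rewrite wE.
rewrite sum_tupleS.
case E : (v0 b) => [u|]; last first.
  rewrite big1 => [|x _]; last by rewrite big1 // => t _; rewrite /c E mul0r.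
  apply/eqP; apply: contraT => /vU /existsP[x xb]; move: E; rewrite /v0.
  by case: pickP => // /(_ x); rewrite xb.
rewrite (bigD1 u) //= [X in _ + X]big1 ?addr0; last first.
  move=> x /negPf xu; rewrite big1 // => t _.
  rewrite /c E theadE; have [[ux]|_] := eqVneq (Some u) (Some x); last by rewrite mul0r.
  by rewrite ux eqxx in xu.
transitivity (\sum_(t : i.-tuple V) strand b v t * face_coef (u :: t) s); last first.
  apply: eq_bigr => t _; rewrite /c E theadE eqxx; congr (strand _ _ _ * _).
  exact: val_inj.
rewrite face_coef_cons_sum.
have -> : \sum_(t : i.-tuple V) (tval s == t)%:R * strand b v t = strand b v s.
  rewrite (bigD1 s) //= eqxx mul1r big1 ?addr0 // => t.
  by rewrite -val_eqE /= eq_sym => /negPf ->; rewrite mul0r.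
clear v0 c B vB w wE E vU.
case: i v vz s => [|i] v vz s.
  by rewrite [s]tuple0 /= subr0.
case: s => [[//|x s] ss] /=; have /= -> := vz b (@Tuple i V s ss).
by rewrite mulr0 subr0.
Qed.

Definition tuple_aug : 'cV[R]_(tuple_rank 0) := const_mx 1.

Lemma mul_aug (v : 'rV[R]_(tuple_rank 0)) :
  (v *m tuple_aug) 0 0 = v 0 (enum_rank [tuple]).
Proof.
rewrite mxE (reindex (@enum_rank _)) /=; last exact/onW_bij/enum_rank_bij.
rewrite (bigD1 [tuple]) //= mxE mulr1 big1 ?addr0 // => t.
by move=> /eqP[]; exact: tuple0.
Qed.

Lemma strand_aug b (v : 'rV[R]_(tuple_rank 0)) :
  strand b v [tuple] = ((v *m tuple_aug) 0 0)@_b.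
Proof.
rewrite mul_aug /strand (_ : lcms _ = 0%MM) // subm0.
by case: ifP => // /mnm_lepP[] i; rewrite mnm0E.
Qed.

Lemma tuple_d_homog i (k : 'I_(tuple_rank i.+1)) (l : 'I_(tuple_rank i)) m :
    m \in msupp (tuple_mx i k l) ->
  (mdeg (lcms (tuple_val k)))%:Z = (mdeg (lcms (tuple_val l)))%:Z + (mdeg m)%:Z.
Proof.
rewrite mxE mcoeff_msupp mcoeffZ mulf_eq0 negb_or => /andP[/face_coef_neq0_lcms le].
rewrite mcoeffX; case: (_ =P m) => [<- _|_]; last by rewrite eqxx.
by rewrite -PoszD -mdegD addmC submK.
Qed.

Lemma tuple_aug_homog (k : 'I_(tuple_rank 0)) m :
    m \in msupp (tuple_aug k 0) ->
  (mdeg (lcms (tuple_val k)))%:Z = (mdeg m)%:Z.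
Proof.
rewrite mxE msupp1 inE => /eqP ->.
by rewrite [tuple_val k]tuple0.
Qed.

Lemma tuple_surj :
  exists v : 'rV_(tuple_rank 0), mideal gen_by ((v *m tuple_aug) 0 0 - 1).
Proof.
by exists (const_mx 1); rewrite mul_aug mxE subrr; exact: mideal0.
Qed.

Lemma tuple_exact0 (v : 'rV[R]_(tuple_rank 0)) :
  mideal gen_by ((v *m tuple_aug) 0 0) <-> exists w, v = w *m tuple_mx 0.
Proof.
split=> [vU|[w ->] b].
  apply: tuple_mx_exact => // b t; rewrite [t]tuple0 strand_aug -mcoeff_msupp.
  exact: vU.
rewrite mcoeff_msupp -strand_aug strand_mulmx.
apply: contraR => nUb; apply/eqP/big1 => s _; rewrite /strand lem_lcms.
case: ifP => [/allP sb|]; last by rewrite mul0r.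
case/negP: nUb; apply/existsP; exists (thead s).
by apply: sb; rewrite (tuple_eta s) mem_head.
Qed.

Lemma tuple_exact i (v : 'rV[R]_(tuple_rank i.+1)) :
  v *m tuple_mx i = 0 <-> exists w, v = w *m tuple_mx i.+1.
Proof.
split=> [vz|[w ->]]; last exact: tuple_mx_mul.
apply: tuple_mx_exact => [b t|b r]; last by rewrite -strand_mulmx vz strand0.
rewrite /strand lem_lcms; case: ifP => [/allP tb _|]; last by rewrite eqxx.
apply/existsP; exists (thead t).
by apply: tb; rewrite (tuple_eta t) mem_head.
Qed.

Definition tuple_resolution : graded_free_resolution (mideal gen_by : set R) :=
  GradedFreeResolution tuple_d_homog tuple_aug_homog tuple_surj
    tuple_exact0 tuple_exact.

(** A minimal generator is a generator of the free module in position 1, and it is not hit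
modulo the variables: the boundary of a pair (x, y) has a nonzero constant coefficient
at [u] only if the least common multiple of x and y is [u], so that x = y = u by
minimality and the two faces cancel. *)
Lemma tor1_neq0 u : g u != 0%MM -> (forall v, (g v <= g u)%MM -> v = u) ->
  tor_neq0 (mideal gen_by : set R) 1 (mdeg (g u))%:Z.
Proof.
move=> gu0 umin; exists tuple_resolution.
pose k : 'I_(tuple_rank 1) := enum_rank [tuple u].
have lcm1 v : lcms [:: v] = g v by rewrite /= mlcm0.
exists (delta_mx 0 k); split.
- move=> l; rewrite mxE eqxx /=; have [->|_] := eqVneq l k; last by rewrite eqxx.
  by move=> _; rewrite /= /tuple_val enum_rankK lcm1.
- apply/rowP => l; rewrite -rowE !mxE mcoeffZ mcoeffX /tuple_val enum_rankK lcm1.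
  rewrite [enum_val l]tuple0 /= subm0.
  by rewrite (negPf gu0) mulr0.
move=> [w [_ /rowP/(_ k)]]; rewrite mxE !eqxx mxE big1 => [/eqP|s _].
  by rewrite oner_eq0.
rewrite [res_dK _ _ _ _]mxE [res_d _ _ _ _]mxE mcoeffZ mcoeffX /tuple_val enum_rankK lcm1.
case/tupleP: (enum_val s) => x t; case/tupleP: t => y t; rewrite [t]tuple0 /=.
have [E|_] := eqVneq _ 0%MM; last by rewrite !mulr0.
have xyu : (mlcm (g x) (mlcm (g y) 0) <= g u)%MM.
  apply/mnm_lepP => i; have := congr1 (fun m => m i) E.
  by rewrite mnmBE mnm0E => /eqP.
move: xyu; rewrite !lem_mlcm => /and3P[/umin -> /umin -> _].
by rewrite !eqxx subr0 !mulr1 subrr ?mul0r mulr0.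
Qed.

End SimplicialResolution.

(** * Associated primes of an irredundant intersection *)

Section Primes.
Local Open Scope ring_scope.
Variable R : comNzRingType.
Implicit Types (I p q : set R) (f g u v : R).

Lemma proper_idealP I : is_proper_ideal I <->
  [/\ I 0, ~ I 1 & forall a u v, I u -> I v -> I (a * u + v)].
Proof.
rewrite /is_proper_ideal /idealr_closed; split=> [[]|[I0 I1 IM]].
  rewrite !in_setE => I0 /negP I1 IM; split=> //.
    by move=> h; apply: I1; rewrite in_setE.
  by move=> a u v Iu Iv; have := IM a u v; rewrite !in_setE; apply.
split; first by rewrite in_setE.
  by apply/negP; rewrite in_setE.
by move=> a u v; rewrite !in_setE; apply: IM.
Qed.

Lemma prime_idealP p : prime_ideal p <->
  is_proper_ideal p /\ (forall u v, p (u * v) -> p u \/ p v).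
Proof.
rewrite /prime_ideal /prime_idealr_closed; split=> -[pp pM]; split=> // u v.
  by move=> puv; have := pM u v; rewrite !in_setE => /(_ puv) /orP[]; rewrite in_setE; [left|right].
rewrite in_setE => /pM h; apply/orP.
by case: h => h; [left|right]; rewrite in_setE.
Qed.

Lemma ideal_mulr I f g : is_proper_ideal I -> I f -> I (g * f).
Proof. by move=> /proper_idealP[I0 _ IM] If; rewrite -[_ * _]addr0; apply: IM. Qed.

Lemma prime_prod p (T : finType) (D : {set T}) (a : T -> R) : prime_ideal p ->
  p (\prod_(t in D) a t) -> exists2 t, t \in D & p (a t).
Proof.
move=> /prime_idealP[/proper_idealP[_ p1 _] pM].
elim/big_rec: _ => // t y tD IH /pM[]; first by exists t.
exact: IH.
Qed.

Section Irredundant.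
Variables (T : finType) (D : {set T}) (P : T -> set R) (I : set R).
Hypothesis P_prime : forall t, t \in D -> prime_ideal (P t).
Hypothesis I_cap : forall f, I f <-> forall t, t \in D -> P t f.
Hypothesis irred : forall t, t \in D ->
  exists f, ~ P t f /\ forall s, s \in D -> s != t -> P s f.

Lemma irredundant_inj : {in D &, injective P}.
Proof.
move=> s t sD tD E; apply/eqP; apply: contraT => nst.
by have [f [ntf sf]] := irred tD; case: ntf; rewrite -E; apply: sf.
Qed.

(** The colon ideal of I by [f] is the intersection of the colon ideals of the P t by
[f], that is, of the P t that do not contain [f].  If it is prime, it contains one of them,
hence equals it; and irredundancy provides an [f] that singles out a given P t. *)
Lemma ass_irredundant q : ass I q <-> exists2 t, t \in D & q = P t.
Proof.
split=> [[q_pr [f qE]]|[t tD ->]]; last first.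
  split; first exact: P_prime.
  have [f [ntf sf]] := irred tD; exists f; apply/funext => g; apply/propext.
  have /prime_idealP[tprop tM] := P_prime tD.
  split=> [tg|/I_cap /(_ t tD) /tM []//].
  apply/I_cap => s sD; have [->|nst] := eqVneq s t.
    by rewrite mulrC; apply: ideal_mulr.
  by apply: ideal_mulr; [have [] := P_prime sD | apply: sf].
have [t tD [ntf tq]] : exists2 t, t \in D & ~ P t f /\ (forall g, P t g -> q g).
  apply: contrapT => none.
  (* If no such P t lies in q, the product of elements outside q chosen in each of them
     lies in all of them, hence in q, against primality. *)
  have /choice[a aP] : forall t, exists a, t \in D -> P t f \/ (P t a /\ ~ q a).
    move=> t; have [tD|] := boolP (t \in D); last by exists 0.
    have [tf|ntf] := pselect (P t f); first by exists 0 => _; left.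
    apply: contrapT => na; apply: none; exists t => //; split=> // g tg.
    by apply: contrapT => nqg; apply: na; exists g => _; right.
  pose D' := [set t in D | `[< ~ P t f >]].
  have : q (\prod_(t in D') a t).
    rewrite qE; apply/I_cap => t tD.
    have [tprop _] := P_prime tD.
    have [tf|ntf] := pselect (P t f); first exact: ideal_mulr.
    have tD' : t \in D' by rewrite inE tD; apply/asboolP.
    rewrite mulrC; apply: ideal_mulr => //; rewrite (bigD1 t) //= mulrC.
    by apply: ideal_mulr => //; have [//|[]] := aP t tD.
  move=> /(prime_prod q_pr)[t]; rewrite inE => /andP[tD /asboolP ntf] qa.
  by have [//|[]] := aP t tD.
exists t => //; apply/funext => g; apply/propext; split=> [|/tq //].
have /prime_idealP[_ tM] := P_prime tD.
by rewrite qE => /I_cap /(_ t tD) /tM [].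
Qed.

End Irredundant.


End Primes.

(** * Squarefree ideals and antichains of sets of variables *)

Section Combinatorics.
Local Open Scope ring_scope.
Variables (K : fieldType) (n : nat).
Local Notation R := {mpoly K[n]}.
Implicit Types (f : R) (g m : 'X_{1..n}) (U : pred 'X_{1..n}).
Implicit Types (A B T : {set 'I_n}) (AA : {set {set 'I_n}}) (i x : 'I_n).

Lemma mideal_mono U m : mideal U ('X_[m] : R) <-> U m.
Proof.
split=> [h|Um m']; first by apply: h; rewrite msuppX inE.
by rewrite msuppX inE => /eqP ->.
Qed.

Lemma mideal_eq U U' : (mideal U : set R) = mideal U' <-> U =1 U'.
Proof.
split=> [E m|/funext -> //].
by apply/idP/idP => /mideal_mono; [rewrite E|rewrite -E]; move=> /mideal_mono.
Qed.

Lemma mideal1 U : mideal U (1 : R) <-> U 0%MM.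
Proof. by rewrite -mpolyX0; exact: mideal_mono. Qed.

Lemma mideal_proper U : upclosed U -> ~~ U 0%MM -> is_proper_ideal (mideal U : set R).
Proof.
move=> upU U0; apply/proper_idealP; split; first exact: mideal0.
  by move=> /mideal1; apply/negP.
by move=> a u v Uu Uv; apply: midealD => //; apply: midealM.
Qed.

Definition mono_gen (M : set 'X_{1..n}) : pred 'X_{1..n} :=
  fun m => `[< exists g, M g /\ (g <= m)%MM >].

Lemma mono_gen_upclosed M : upclosed (mono_gen M).
Proof.
move=> m d /asboolP[g [Mg gm]]; apply/asboolP; exists g; split=> //.
exact: lepm_trans gm (lem_addl _ _).
Qed.

Lemma monomials_genE (M : set 'X_{1..n}) : monomials_gen K M = mideal (mono_gen M).
Proof.
apply/funext => f; apply/propext; split.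
  case=> s [sM ->]; rewrite big_seq; apply: mideal_sum => p /sM [g Mg <-].
  apply: midealM; first exact: mono_gen_upclosed.
  by apply/mideal_mono/asboolP; exists g; split=> //; exact: lepm_refl.
move=> fU; have /choice[c cP] : forall m, exists g, mono_gen M m -> M g /\ (g <= m)%MM.
  move=> m; have [/asboolP[g gP]|_] := boolP (mono_gen M m); first by exists g.
  by exists m.
exists [seq (f@_m *: 'X_[m - c m], 'X_[c m]) | m <- msupp f]; split.
  by move=> p /mapP[m /fU/cP[Mc _] -> /=]; exists (c m).
rewrite big_map [LHS]mpolyE [LHS]big_seq [RHS]big_seq; apply: eq_bigr => m /fU/cP[_ cm] /=.
by rewrite -scalerAl -mpolyXD submK.
Qed.

Definition hit A : pred 'X_{1..n} := fun m => [exists i in A, (0 < m i)%N].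
(** For a set [AA] of sets of variables, [capP AA] is the intersection of the prime ideals
generated by the members of [AA]; its monomials are those meeting every member. *)
Definition hits AA : pred 'X_{1..n} := fun m => [forall A in AA, hit A m].
Definition capP AA : set R := mideal (hits AA).
Definition ind T : 'X_{1..n} := [multinom (i \in T : nat) | i < n].
Definition supp m : {set 'I_n} := [set i | (0 < m i)%N].

Lemma hitP A m : reflect (exists2 i, i \in A & (0 < m i)%N) (hit A m).
Proof. exact: exists_inP. Qed.

Lemma hitsP AA m : reflect (forall A, A \in AA -> hit A m) (hits AA m).
Proof. exact: forall_inP. Qed.

Lemma hit_lem A m m' : (m <= m')%MM -> hit A m -> hit A m'.
Proof.
by move=> /mnm_lepP le /hitP[i iA mi]; apply/hitP; exists i => //; apply: leq_trans (le i).
Qed.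

Lemma hits_lem AA m m' : (m <= m')%MM -> hits AA m -> hits AA m'.
Proof. by move=> le /hitsP h; apply/hitsP => A /h; apply: hit_lem. Qed.

Lemma hits_upclosed AA : upclosed (hits AA).
Proof. by move=> m d; apply: hits_lem; exact: lem_addl. Qed.

Lemma ind_gt0 T i : (0 < ind T i)%N = (i \in T).
Proof. by rewrite mnmE lt0b. Qed.

Lemma ind_lem T m : (ind T <= m)%MM = (T \subset supp m).
Proof.
apply/mnm_lepP/subsetP => [le i iT|sub i]; first by rewrite inE (leq_trans _ (le i)) // ind_gt0.
by rewrite mnmE; case: (boolP (i \in T)) => // /sub; rewrite inE.
Qed.

Lemma supp_ind T : supp (ind T) = T.
Proof. by apply/setP => i; rewrite inE ind_gt0. Qed.

Lemma hit_supp A m : hit A (ind (supp m)) = hit A m.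
Proof. by apply: eq_existsb => i; rewrite ind_gt0 inE. Qed.

Lemma hits_supp AA m : hits AA (ind (supp m)) = hits AA m.
Proof. by apply: eq_forallb => A; rewrite hit_supp. Qed.

Lemma hit_ind A T : hit A (ind T) = (A :&: T != set0).
Proof.
apply/hitP/set0Pn => [[i iA]|[i]].
  by rewrite ind_gt0 => iT; exists i; rewrite inE iA.
by rewrite inE => /andP[iA iT]; exists i; rewrite ?ind_gt0.
Qed.

Lemma hit_indC A B : hit B (ind (~: A)) = ~~ (B \subset A).
Proof. by rewrite hit_ind -setDE setD_eq0. Qed.

Definition antichain AA := forall A B, A \in AA -> B \in AA -> A \subset B -> A = B.

Definition minsets AA := [set A | minset (mem AA) A].

Lemma minsets_antichain AA : antichain (minsets AA).
Proof.
move=> A B; rewrite !inE => /minsetP[AA1 _] /minsetP[_ Bmin] sub.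
exact: Bmin.
Qed.

Lemma hits_minsets AA : hits (minsets AA) =1 hits AA.
Proof.
move=> m; apply/hitsP/hitsP => h A AA1; last first.
  by apply: h; move: AA1; rewrite inE => /minsetP[].
have [B Bmin sub] := @minset_exists _ (mem AA) A AA1.
have /hitP[i iB mi] := h B (ltac:(by rewrite inE)).
by apply/hitP; exists i => //; apply: (subsetP sub).
Qed.

(** If no squarefree generator divides [m], then every generator involves a variable
outside [m], so the prime generated by the variables outside [m] contains I and misses
[m]. *)
Lemma squarefree_capP (I : set R) :
  squarefree_monomial_ideal I -> exists AA, antichain AA /\ I = capP AA.
Proof.
case=> M [sqf ->]; rewrite monomials_genE.
pose AA := [set A | `[< forall g, M g -> hit A g >]].
exists (minsets AA); split; first exact: minsets_antichain.
apply/mideal_eq => m; rewrite hits_minsets.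
apply/asboolP/hitsP => [[g [Mg gm]] A|h].
  by rewrite inE => /asboolP /(_ g Mg); exact: hit_lem.
apply: contrapT => none.
have /h : (~: supp m) \in AA.
  rewrite inE; apply/asboolP => g Mg.
  have : ~~ (g <= m)%MM by apply/negP => le; apply: none; exists g.
  move=> /mnm_lepP/existsNP[i /negP]; rewrite -ltnNge => mg.
  have gi : g i = 1%N by apply/eqP; rewrite eqn_leq sqf //= (leq_trans _ mg).
  apply/hitP; exists i; last by rewrite gi.
  by rewrite !inE -leqNgt; move: mg; rewrite gi ltnS.
by move=> /hitP[i]; rewrite !inE => /negPf ->.
Qed.

Lemma mideal_partition U f : exists a b : R,
  [/\ f = a + b, mideal U a & mideal (predC U) b].
Proof.
have bnd m : (msize f <= mdeg m)%N -> f@_m = 0.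
  by move=> le; apply: memN_msupp_eq0; apply: msize_mdeg_ge.
have [m|a aE] := @mpoly_of_coeffs K n (fun m => if U m then f@_m else 0) (msize f).
  by move=> /bnd ->; case: ifP.
have [m|b bE] := @mpoly_of_coeffs K n (fun m => if U m then 0 else f@_m) (msize f).
  by move=> /bnd ->; case: ifP.
exists a, b; split.
- by apply/mpolyP => m; rewrite mcoeffD aE bE; case: ifP; rewrite ?addr0 ?add0r.
- by move=> m; rewrite mcoeff_msupp aE; case: ifP => //; rewrite eqxx.
- by move=> m; rewrite mcoeff_msupp bE /=; case: ifP => //; rewrite eqxx.
Qed.

(** Modulo the ideal every polynomial is a combination of monomials outside [U], and such
combinations form a subring of a domain by the hypothesis on [U]. *)
Lemma mideal_prime U : upclosed U -> ~~ U 0%MM ->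
    (forall m m', U (m + m')%MM -> U m || U m') ->
  prime_ideal (mideal U : set R).
Proof.
move=> upU U0 UM; apply/prime_idealP; split; first exact: mideal_proper.
move=> u v uvU.
have [a [b [uE aU bU]]] := mideal_partition U u.
have [c [d [vE cU dU]]] := mideal_partition U v.
have bdU : mideal U (b * d).
  have -> : b * d = u * v - (v * a + b * c) by rewrite uE vE; ring.
  by apply: midealB => //; apply: midealD; apply: midealM.
have : b * d = 0.
  apply: msuppnil0; case E : (msupp (b * d)) => [//|m s].
  have mbd : m \in msupp (b * d) by rewrite E mem_head.
  have /allpairsP[[m1 m2] /= [/bU /= /negPf n1 /dU /= /negPf n2 mE]] := msuppM_le mbd.
  by have := bdU _ mbd; rewrite mE => /UM; rewrite n1 n2.
move/eqP; rewrite mulf_eq0 => /orP[/eqP b0|/eqP d0]; [left|right].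
  by rewrite uE b0 addr0.
by rewrite vE d0 addr0.
Qed.

End Combinatorics.

Arguments capP K {n} AA.

(** * Decomposing variables of squarefree ideals *)

Section AssOfSquarefree.
Local Open Scope ring_scope.
Variables (K : fieldType) (n : nat).
Local Notation R := {mpoly K[n]}.
Implicit Types (f : R) (g m : 'X_{1..n}) (U : pred 'X_{1..n}).
Implicit Types (A B T : {set 'I_n}) (AA : {set {set 'I_n}}) (i x : 'I_n).
Local Notation capP := (@capP K n).
Local Notation primeP A := (capP [set A]).

Lemma hits_set1 A : hits [set A] =1 hit A.
Proof.
move=> m; apply/hitsP/idP => [h|h B]; first by apply: h; rewrite inE.
by rewrite inE => /eqP ->.
Qed.

Lemma capP_mono AA m : capP AA 'X_[m] <-> hits AA m.
Proof. exact: mideal_mono. Qed.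

Lemma capPE AA f : capP AA f <-> forall A, A \in AA -> primeP A f.
Proof.
split=> [h A AA1 m /h /hitsP /(_ A AA1)|h m mf]; first by rewrite hits_set1.
by apply/hitsP => A /h /(_ m mf); rewrite hits_set1.
Qed.

Lemma hit0 A : hit A (0%MM : 'X_{1..n}) = false.
Proof. by apply/hitP => -[i _]; rewrite mnm0E. Qed.

Lemma primeP_prime A : prime_ideal (primeP A).
Proof.
apply: mideal_prime; first exact: hits_upclosed.
  by rewrite hits_set1 hit0.
move=> m m'; rewrite !hits_set1 => /hitP[i iA]; rewrite mnmDE addn_gt0.
by case/orP => mi; apply/orP; [left|right]; apply/hitP; exists i.
Qed.

Lemma capP_X AA i : capP AA ('X_i) <-> forall A, A \in AA -> i \in A.
Proof.
rewrite capP_mono; split=> [/hitsP h A /h /hitP[j jA]|h].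
  by rewrite mnm1E; case: eqP => // ->.
by apply/hitsP => A /h iA; apply/hitP; exists i; rewrite ?mnm1E ?eqxx.
Qed.

Lemma primeP_X A i : primeP A ('X_i) <-> i \in A.
Proof.
by rewrite capP_X; split=> [/(_ A)|iA B]; rewrite inE; [apply|move=> /eqP ->].
Qed.

Lemma primeP_inj : injective (fun A => primeP A).
Proof.
move=> A B E; apply/setP => i; apply/idP/idP => /primeP_X.
  by rewrite E => /primeP_X.
by rewrite -E => /primeP_X.
Qed.

(** The product of the variables outside [A] lies in every member of the intersection
except the prime generated by [A]. *)
Lemma antichain_irred AA A : antichain AA -> A \in AA ->
  exists f, ~ primeP A f /\ forall B, B \in AA -> B != A -> primeP B f.
Proof.
move=> anti AAA; exists 'X_[ind (~: A)]; split=> [|B BAA ne].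
  by rewrite capP_mono hits_set1 hit_indC subxx.
apply/capP_mono; rewrite hits_set1 hit_indC.
by apply: contra ne => sub; apply/eqP; apply: anti.
Qed.

Lemma ass_capP AA q : antichain AA ->
  ass (capP AA) q <-> exists2 A, A \in AA & q = primeP A.
Proof.
move=> anti; apply: ass_irredundant.
- by move=> A _; exact: primeP_prime.
- exact: capPE.
- by move=> A; exact: antichain_irred.
Qed.

Lemma irreducibility_index_card AA r : antichain AA ->
  irreducibility_index (capP AA) r -> r = #|AA|.
Proof.
move=> anti [P [Ppr Icap Iirr]].
have cap f : capP AA f <-> forall t, t \in [set: 'I_r] -> P t f.
  by rewrite Icap; split=> h t *; apply: h.
have irred t : t \in [set: 'I_r] ->
    exists f, ~ P t f /\ forall s, s \in [set: 'I_r] -> s != t -> P s f.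
  move=> _; apply: contrapT => none; case: (Iirr t); apply/funext => f; apply/propext.
  split=> [/cap h s _|h]; first exact: h.
  apply/cap => s _; have [->|ne] := eqVneq s t; last by apply: h; apply/eqP.
  apply: contrapT => ntf; apply: none; exists f; split=> // u _ ne.
  by apply: h; apply/eqP.
have assP q : ass (capP AA) q <-> exists2 t, t \in [set: 'I_r] & q = P t.
  by apply: ass_irredundant => // t _; exact: Ppr.
have Pinj : injective P.
  by move=> s t; apply: (irredundant_inj irred); rewrite inE.
have /fin_all_exists[c cP] : forall t, exists A, A \in AA /\ P t = primeP A.
  move=> t; have /ass_capP[//|A AAA ->] : ass (capP AA) (P t) by apply/assP; exists t.
  by exists A.
have cinj : injective c.
  by move=> s t E; apply: Pinj; have [_ ->] := cP s; have [_ ->] := cP t; rewrite E.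
rewrite -[LHS]card_ord -(card_imset _ cinj); apply: eq_card => A.
apply/imsetP/idP => [[t _ ->]|AAA]; first by have [] := cP t.
have /assP[t _ E] : ass (capP AA) (primeP A) by apply/ass_capP => //; exists A.
by exists t => //; apply: primeP_inj; rewrite /= E; have [_ ->] := cP t.
Qed.

Lemma capP_proper AA : is_proper_ideal (capP AA) <-> AA != set0.
Proof.
split=> [/proper_idealP[_ c1 _]|/set0Pn[A AAA]].
  by apply/eqP => E; apply: c1; rewrite -mpolyX0; apply/capP_mono/hitsP => A; rewrite E inE.
apply: mideal_proper; first exact: hits_upclosed.
by apply/hitsP => /(_ A AAA); rewrite hit0.
Qed.

Lemma hits_muln AA m k : hits AA (m *+ k)%MM -> hits AA m.
Proof.
move=> /hitsP h; apply/hitsP => A /h /hitP[i iA mi]; apply/hitP; exists i => //.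
by move: mi; rewrite mulmnE muln_gt0 => /andP[].
Qed.

Lemma capP_radicalX AA i : radical (capP AA) ('X_i) -> capP AA ('X_i).
Proof. by case=> k; rewrite mpolyXn !capP_mono; exact: hits_muln. Qed.

(** If [f] is the product of the variables outside some member [A], and [y] is in [A], then
[f y] is in the ideal and [f] is not; so [y], being in the radical, is in every member. *)
Lemma primary_capP AA : antichain AA -> primary_ideal (capP AA) ->
  exists A, AA = [set A].
Proof.
move=> anti [/capP_proper/set0Pn[A AAA] prim]; exists A.
suff sub B : B \in AA -> A \subset B.
  by apply/setP => B; rewrite inE; apply/idP/eqP => [BAA|-> //]; apply/esym/anti => //; exact: sub.
move=> BAA; apply/subsetP => i iA.
have : capP AA ('X_[ind (~: A)] * 'X_i).
  apply/capPE => C CAA; have [->|ne] := eqVneq C A.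
    have [pr _] := primeP_prime A; apply: (ideal_mulr _ pr).
    exact/primeP_X.
  have [pr _] := primeP_prime C; rewrite mulrC; apply: (ideal_mulr _ pr).
  apply/capP_mono; rewrite hits_set1 hit_indC.
  by apply: contra ne => s; apply/eqP; apply: anti.
move=> /prim[/capP_mono /hitsP /(_ A AAA)|]; first by rewrite hit_indC subxx.
by move=> /capP_radicalX /capP_X; apply.
Qed.

Lemma addX_mideal U x k : upclosed U ->
  ideal_addX (mideal U : set R) x k = mideal (fun m => U m || (k <= m x)%N).
Proof.
move=> upU; apply/funext => f; apply/propext; split.
  case=> a [b [aU [s [sX ->]] ->]]; apply: midealD => [m /aU -> //|].
  rewrite big_seq; apply: mideal_sum => p /sX ->; apply: midealM.
    move=> m d /orP[/upU -> //|km].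
    by rewrite mnmDE (leq_trans km) ?orbT // leq_addl.
  rewrite mpolyXn; apply/mideal_mono.
  by rewrite mulmnE mnm1E eqxx mul1n leqnn orbT.
move=> fU; have [a [b [fE aU bU]]] := mideal_partition U f.
have bx m : m \in msupp b -> (k <= m x)%N.
  move=> mb; have /negPf nU := bU m mb; suff /fU : m \in msupp f by rewrite nU.
  rewrite fE mcoeff_msupp mcoeffD memN_msupp_eq0 ?add0r -?mcoeff_msupp //.
  by apply/negP => /aU; rewrite nU.
exists a, b; split=> //.
exists [seq (b@_m *: 'X_[m - U_(x) *+ k], 'X_x ^+ k) | m <- msupp b]; split.
  by move=> p /mapP[m _ ->].
rewrite big_map [LHS]mpolyE [LHS]big_seq [RHS]big_seq; apply: eq_bigr => m /bx mx /=.
rewrite mpolyXn -scalerAl -mpolyXD submK //; apply/mnm_lepP => i.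
by rewrite mulmnE mnm1E; case: eqP => [<-|]; rewrite ?mul1n.
Qed.

Lemma colonX_mideal U x k :
  colonX (mideal U : set R) x k = mideal (fun m => U (m + U_(x) *+ k)%MM).
Proof.
apply/funext => f; apply/propext.
by rewrite /colonX /colon /= mpolyXn mulrC; exact: midealXM.
Qed.

Definition with_var x AA := [set A in AA | x \in A].
Definition without_var x AA := [set A in AA | x \notin A].

Lemma antichain_sub AA AA' : AA' \subset AA -> antichain AA -> antichain AA'.
Proof. by move=> /subsetP sub anti A B /sub A1 /sub B1; apply: anti. Qed.

Lemma colonX_capP AA x k : (0 < k)%N ->
  colonX (capP AA) x k = capP (without_var x AA).
Proof.
move=> k0; rewrite colonX_mideal; apply/mideal_eq => m.
apply/hitsP/hitsP => h A.
  rewrite inE => /andP[/h /hitP[i iA] + xA]; rewrite mnmDE mulmnE mnm1E.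
  have [xi|_] := eqVneq x i; first by rewrite -xi (negPf xA) in iA.
  by rewrite mul0n addn0 => mi; apply/hitP; exists i.
move=> AAA; have [xA|xA] := boolP (x \in A).
  by apply/hitP; exists x => //; rewrite mnmDE mulmnE mnm1E eqxx mul1n addn_gt0 k0 orbT.
by apply: (hit_lem (lem_addr _ _)); apply: h; rewrite inE AAA.
Qed.

Lemma without_var_neq0 AA x : ~ radical (capP AA) 'X_x -> without_var x AA != set0.
Proof.
move=> nx; apply/eqP => E; apply: nx; exists 1%N; rewrite expr1.
apply/capP_X => A AAA; apply: contraT => xA.
have : A \in without_var x AA by rewrite inE AAA.
by rewrite E inE.
Qed.

(** For k > 1 and a member [A] not containing x, the monomial x^(k-1) times the product of
the variables outside [A] and different from x has colon ideal generated by x and [A].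
This prime would be associated to I while strictly containing the associated prime
generated by [A]. *)
Lemma splits_exponent AA x k : antichain AA -> ass_splits (capP AA) x k -> k = 1%N.
Proof.
move=> anti [nx k0 assE]; apply/eqP; apply: contraT => k1.
have {k0 k1} k2 : (1 < k)%N by case: k k0 k1 {assE} => [|[]].
have /set0Pn[A] := without_var_neq0 nx; rewrite inE => /andP[AAA xA].
have : ass (ideal_addX (capP AA) x k) (primeP (x |: A)).
  split; first exact: primeP_prime.
  pose w := (ind (~: (x |: A)) + U_(x) *+ k.-1)%MM; exists 'X_[w].
  rewrite addX_mideal; last exact: hits_upclosed.
  suff E : hits [set x |: A] =1
      (fun m => hits AA (m + w)%MM || (k <= (m + w)%MM x)%N).
    apply/funext => f; apply/propext; rewrite /colon /= mulrC midealXM.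
    by rewrite -(funext E).
  move=> m; rewrite hits_set1 /w.
  have mx : (k <= (m + (ind (~: (x |: A)) + U_(x) *+ k.-1))%MM x)%N = (0 < m x)%N.
    rewrite !mnmDE mulmnE mnm1E eqxx mnmE !inE eqxx /=; lia.
  rewrite mx; apply/hitP/orP => [[i]|[/hitsP /(_ A AAA) /hitP[i iA]|mx0]].
  - rewrite !inE => /orP[/eqP -> ->|iA mi]; [by right|left].
    apply/hitsP => B BAA; have [->|ne] := eqVneq B A.
      by apply/hitP; exists i => //; rewrite mnmDE addn_gt0 mi.
    have /subsetPn[j jB jA] : ~~ (B \subset A).
      by apply: contra ne => s; apply/eqP; apply: anti.
    apply/hitP; exists j => //; rewrite !mnmDE mulmnE mnm1E mnmE !inE negb_or jA andbT.
    by rewrite [x == j]eq_sym; case: (j == x) => /=; lia.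
  - rewrite !mnmDE mulmnE mnm1E mnmE !inE negb_or iA andbF.
    case: (eqVneq x i) => [xi|_]; first by rewrite -xi (negPf xA) in iA.
    by rewrite mul0n !addn0 => mi; exists i; rewrite // !inE iA orbT.
  - by exists x; rewrite // !inE eqxx.
rewrite assE => -[/ass_capP[//|B BAA /primeP_inj E] _].
have AB : A = B by apply: anti => //; rewrite -E subsetUr.
by rewrite AB -E !inE eqxx in xA.
Qed.

(** As I + (x) is squarefree, it is the intersection of its associated primes, which the
splitting condition identifies as those of I containing x. *)
Lemma addX_capP AA x : antichain AA -> ass_splits (capP AA) x 1 ->
  ideal_addX (capP AA) x 1 = capP (with_var x AA).
Proof.
move=> anti [nx _ assE].
pose BB := minsets [set x |: A | A in AA].
have addE : ideal_addX (capP AA) x 1 = capP BB.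
  rewrite addX_mideal; last exact: hits_upclosed.
  apply/mideal_eq => m; rewrite hits_minsets.
  apply/idP/hitsP => [/orP[/hitsP h|mx] _ /imsetP[A AAA ->]|h].
  - have /hitP[i iA mi] := h A AAA.
    by apply/hitP; exists i; rewrite // !inE iA orbT.
  - by apply/hitP; exists x; rewrite // !inE eqxx.
  - have [//|mx] := boolP (0 < m x)%N; first by rewrite orbT.
    rewrite orbF; apply/hitsP => A AAA.
    have /hitP[i] := h _ (imset_f (fun A => x |: A) AAA).
    rewrite !inE => /orP[/eqP ->|iA mi]; first by rewrite (negPf mx).
    by apply/hitP; exists i.
rewrite addE; congr capP; apply/setP => A.
rewrite addE in assE.
have antiB : antichain BB by exact: minsets_antichain.
apply/idP/idP => [ABB|].
  have : ass (capP BB) (primeP A) by apply/ass_capP => //; exists A.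
  rewrite assE => -[/ass_capP[//|B BAA /primeP_inj E]]; rewrite E.
  by move=> /primeP_X xB; rewrite inE BAA.
rewrite inE => /andP[AAA xA].
have : ass (capP BB) (primeP A).
  by rewrite assE; split; [apply/ass_capP => //; exists A|apply/primeP_X].
by move=> /ass_capP[//|B BBB /primeP_inj ->].
Qed.

End AssOfSquarefree.

(** * The regularity bound and its equality case *)

Section Regularity.
Local Open Scope ring_scope.
Variables (K : fieldType) (n : nat).
Local Notation R := {mpoly K[n]}.
Implicit Types (f : R) (g m : 'X_{1..n}) (U : pred 'X_{1..n}).
Implicit Types (A B T : {set 'I_n}) (AA : {set {set 'I_n}}) (i x : 'I_n) (e : int).
Local Notation capP := (@capP K n).
Local Notation primeP A := (capP [set A]).

Lemma hit_upclosed A : upclosed (hit A : pred 'X_{1..n}).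
Proof. by move=> m d; apply: hit_lem; exact: lem_addl. Qed.

Lemma kvanish_primeP A e : e != 0 -> kvanish (primeP A) e.
Proof.
move=> e0; have -> : primeP A = mideal (hit A) by apply/mideal_eq => m; rewrite hits_set1.
move: {2}#|A| (leqnn #|A|) => N; elim: N A => [|N IHN] A.
  rewrite leqn0 cards_eq0 => /eqP ->.
  have -> : mideal (hit set0) = mideal xpred0 :> set R.
    by apply/mideal_eq => m; apply/hitP => -[i]; rewrite inE.
  exact: kvanish0.
have [->|[x xA]] := set_0Vmem A; first by move=> _; apply: IHN; rewrite cards0.
rewrite (cardsD1 x) xA ltnS => /IHN van.
have -> : mideal (hit A) = mideal (fun m => hit (A :\ x) m || (0 < m x)%N) :> set R.
  apply/mideal_eq => m; apply/hitP/orP => [[i iA mi]|[/hitP[i]|mx]].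
  - have [ix|ix] := eqVneq i x; first by right; rewrite -ix.
    by left; apply/hitP; exists i; rewrite // !inE ix.
  - by rewrite !inE => /andP[_ iA] mi; exists i.
  - by exists x.
apply: kvanish_addvar van; first exact: hit_upclosed.
move=> m /hitP[i]; rewrite !inE => /andP[ix iA]; rewrite mnmDE mnm1E eq_sym (negPf ix) addn0 => mi.
by apply/hitP; exists i; rewrite // !inE ix.
Qed.

(** Minimal sets of variables meeting every member of [AA]: the supports of the minimal
generators of [capP AA]. *)
Definition mintrans AA T := minset (fun T => hits AA (ind T)) T.

Lemma mintransP AA T : reflect
  (hits AA (ind T) /\ forall i, i \in T -> ~~ hits AA (ind (T :\ i)))
  (mintrans AA T).
Proof.
rewrite /mintrans; apply: (iffP minsetP) => -[hT Tmin]; split=> //.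
  by move=> i iT; apply/negP => /Tmin /(_ (subD1set _ _)) /setP/(_ i); rewrite !inE eqxx iT.
move=> T' hT' sub; apply/eqP; rewrite eqEsubset sub /=.
apply/subsetP => i iT; apply: contraT => iT'.
case/negP: (Tmin i iT); apply: hits_lem hT'; rewrite ind_lem supp_ind.
apply/subsetP => j jT'; rewrite !inE (subsetP sub) // andbT.
by apply: contraNneq iT' => <-.
Qed.

(** Each variable of a minimal transversal is the only one in some member, and different
variables give different members. *)
Lemma mintrans_card AA T : mintrans AA T -> (#|T| <= #|AA|)%N.
Proof.
move=> /mintransP[hT Tmin].
rewrite -(card_imset _ (@Some_inj _)).
apply: leq_trans (leq_imset_card (fun A => [pick i in A :&: T]) AA).
apply/subset_leq_card/subsetP => _ /imsetP[i iT ->].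
have /forall_inPn[A AAA] := Tmin i iT; rewrite hit_ind negbK => /eqP AT.
apply/imsetP; exists A => //.
have only j : j \in A :&: T -> j = i.
  rewrite inE => /andP[jA jT]; apply/eqP; apply: contraT => ji.
  by have := in_set0 j; rewrite -AT !inE jA jT ji.
case: pickP => [j /only -> //|none].
by move/hitsP/(_ A AAA): hT; rewrite hit_ind => /set0Pn[j]; rewrite none.
Qed.

Lemma with_without_card AA x : (#|with_var x AA| + #|without_var x AA|)%N = #|AA|.
Proof.
rewrite -(cardsID [set A : {set 'I_n} | x \in A] AA); congr (_ + _)%N; apply: eq_card => A.
  by rewrite !inE.
by rewrite !inE andbC.
Qed.

Lemma decomposition_capP AA x : antichain AA -> ass_splits (capP AA) x 1 ->
    is_proper_ideal (ideal_addX (capP AA) x 1) ->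
  [/\ ideal_addX (capP AA) x 1 = capP (with_var x AA),
      colonX (capP AA) x 1 = capP (without_var x AA),
      (0 < #|with_var x AA|)%N & (0 < #|without_var x AA|)%N].
Proof.
move=> anti spl prop; have E := addX_capP anti spl; split=> //.
- exact: colonX_capP.
- by rewrite card_gt0; apply/(@capP_proper K); rewrite -E.
- by rewrite card_gt0; apply: (@without_var_neq0 K); have [] := spl.
Qed.

Definition vanishes_from AA := forall e, #|AA|%:Z <= e -> kvanish (capP AA) e.

Lemma kvanish_decomposition AA x e : antichain AA -> ass_splits (capP AA) x 1 ->
  kvanish (capP (with_var x AA)) e -> kvanish (capP (without_var x AA)) (e - 1) ->
  kvanish (capP AA) e.
Proof.
move=> anti spl v1 v0; apply: (@kvanish_add_colon _ _ _ x); first exact: hits_upclosed.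
  have := addX_capP anti spl; rewrite addX_mideal; last exact: hits_upclosed.
  by move=> ->.
have := @colonX_capP K _ AA x 1 isT; rewrite colonX_mideal.
by move: v0 => /[swap] <-.
Qed.

Lemma vanishes_from_decomposition AA x : antichain AA -> ass_splits (capP AA) x 1 ->
    (0 < #|with_var x AA|)%N -> (0 < #|without_var x AA|)%N ->
    vanishes_from (with_var x AA) -> vanishes_from (without_var x AA) ->
  vanishes_from AA.
Proof.
move=> anti spl c1 c0 v1 v0 e; rewrite -(with_without_card AA x) => le.
by apply: (kvanish_decomposition anti spl); [apply: v1 | apply: v0]; lia.
Qed.

(** In degree r - 1 the homology of I + (x) vanishes because at least one member avoids
x; so that of I : x does not vanish in degree r - 2, which is possible only if r - 2 is
smaller than the number of members avoiding x. *)
Lemma extremal_decomposition AA x : antichain AA -> ass_splits (capP AA) x 1 ->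
    (0 < #|without_var x AA|)%N -> (0 < #|with_var x AA|)%N ->
    vanishes_from (with_var x AA) -> vanishes_from (without_var x AA) ->
    ~ kvanish (capP AA) (#|AA|%:Z - 1) ->
  #|with_var x AA| = 1%N /\
  ~ kvanish (capP (without_var x AA)) (#|without_var x AA|%:Z - 1).
Proof.
move=> anti spl c0 c1 v1 v0 nv.
have cc := with_without_card AA x.
have nv0 : ~ kvanish (capP (without_var x AA)) (#|AA|%:Z - 1 - 1).
  move=> v; apply: nv; apply: (kvanish_decomposition anti spl) => //.
  by apply: v1; lia.
have c11 : #|with_var x AA| = 1%N.
  by apply/eqP; apply: contra_notT nv0 => ne; apply: v0; lia.
split=> //; move=> v; apply: nv0.
by rewrite (_ : _ - 1 - 1 = #|without_var x AA|%:Z - 1) //; lia.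
Qed.

(** I + (x) is then the prime generated by [B], so a variable of [B] other than x is
in I + (x), hence in I. *)
Lemma with_var1_sub AA x B y : antichain AA -> ass_splits (capP AA) x 1 ->
    with_var x AA = [set B] -> y \in B -> y != x ->
  forall A, A \in AA -> y \in A.
Proof.
move=> anti spl E yB yx; apply/(@capP_X K).
have : ideal_addX (capP AA) x 1 ('X_y) by rewrite addX_capP // E; apply/primeP_X.
rewrite addX_mideal; last exact: hits_upclosed.
move=> /mideal_mono /=; rewrite mnm1E (negPf yx) orbF => h.
exact/capP_mono.
Qed.

(** Let [B] be the only member containing x.  If [T] misses [B], adding x to [T] works.
Otherwise [T] contains a variable of [B], which meets all members by [with_var1_sub];
then [T] is a single variable, [AA] consists of [B] and one other member [A], and x
with a variable of [A] outside [B] works. *)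
Lemma mintrans_extend AA x T : antichain AA -> ass_splits (capP AA) x 1 ->
    #|with_var x AA| = 1%N -> (0 < #|without_var x AA|)%N ->
    mintrans (without_var x AA) T -> #|T| = #|without_var x AA| ->
  exists T', mintrans AA T' /\ #|T'| = #|AA|.
Proof.
move=> anti spl /eqP/cards1P[B BE] c0 /mintransP[hT Tmin] cT.
have sub := with_var1_sub anti spl BE.
have [BAA xB] : B \in AA /\ x \in B.
  by apply/andP; have := set11 B; rewrite -BE inE.
have cAA : #|AA| = #|without_var x AA|.+1 by rewrite -(with_without_card AA x) BE cards1.
have caseAA A : A \in AA -> A = B \/ A \in without_var x AA.
  move=> AAA; have [xA|xA] := boolP (x \in A); last by right; rewrite inE AAA.
  by left; apply/set1P; rewrite -BE inE AAA.
have xT : x \notin T.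
  apply/negP => xT; case/negP: (Tmin x xT); apply/hitsP => A A0.
  have /hitP[i iA] := hitsP _ _ hT A A0; rewrite ind_gt0 => iT.
  apply/hitP; exists i => //; rewrite ind_gt0 !inE iT andbT.
  by apply: contraTneq A0 => <-; rewrite inE iA andbF.
have [TB|TB] := eqVneq (T :&: B) set0.
  exists (x |: T); split; last by rewrite cardsU1 xT cT cAA.
  apply/mintransP; split=> [|i].
    apply/hitsP => A /caseAA[->|A0].
      by apply/hitP; exists x => //; rewrite ind_gt0 !inE eqxx.
    have /hitP[i iA] := hitsP _ _ hT A A0; rewrite ind_gt0 => iT.
    by apply/hitP; exists i => //; rewrite ind_gt0 !inE iT orbT.
  rewrite !inE => /orP[/eqP ->|iT].
    rewrite setU1K //; apply/negP => /hitsP /(_ B BAA).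
    by rewrite hit_ind setIC TB eqxx.
  apply: contra (Tmin i iT) => /hitsP h; apply/hitsP => A A0.
  have /andP[AAA xA] : (A \in AA) && (x \notin A) by rewrite inE in A0.
  have /hitP[j jA] := h A AAA; rewrite ind_gt0 !inE => /andP[ji /orP[/eqP jx|jT]].
    by rewrite -jx jA in xA.
  by apply/hitP; exists j => //; rewrite ind_gt0 !inE ji.
have [y] := set0Pn _ TB; rewrite inE => /andP[yT yB].
have yx : y != x by apply: contraNneq xT => <-.
have yall := sub y yB yx.
have Ty : T = [set y].
  apply/setP => i; rewrite inE; apply/idP/eqP => [iT|-> //].
  apply/eqP; apply: contraT => iy; case/negP: (Tmin i iT); apply/hitsP => A.
  rewrite inE => /andP[/yall yA _]; apply/hitP; exists y => //.
  by rewrite ind_gt0 !inE yT andbT eq_sym.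
have c01 : #|without_var x AA| = 1%N by rewrite -cT Ty cards1.
have /eqP/cards1P[A AE] := c01.
have [AAA xA] : A \in AA /\ x \notin A.
  by apply/andP; have := set11 A; rewrite -AE inE.
have /subsetPn[z zA zB] : ~~ (A \subset B).
  by apply: contraNN xA => s; rewrite (anti A B).
have xz : x != z by apply: contraNneq xA => ->.
exists [set x; z]; split; last by rewrite cards2 xz cAA c01.
apply/mintransP; split=> [|i].
  apply/hitsP => C /caseAA[->|].
    by apply/hitP; exists x => //; rewrite ind_gt0 !inE eqxx.
  rewrite AE inE => /eqP ->.
  by apply/hitP; exists z => //; rewrite ind_gt0 !inE eqxx orbT.
rewrite !inE => /orP[]/eqP->; apply/negP => /hitsP h.
  have /hitP[j jB] := h B BAA; rewrite ind_gt0 !inE => /andP[/negPf -> /= /eqP jz].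
  by rewrite -jz jB in zB.
have /hitP[j jA] := h A AAA; rewrite ind_gt0 !inE => /andP[/negPf ->]; rewrite orbF => /eqP jx.
by rewrite -jx jA in xA.
Qed.

Lemma assdec_proper (I : set R) : ass_decomposable I -> is_proper_ideal I.
Proof. by case=> [_ []|]. Qed.

(** The second part excludes the zero ideal, the only prime without generators: its
regularity is 0, but no generator has degree 1. *)
Lemma assdec_regularity (I : set R) : ass_decomposable I ->
  forall AA, antichain AA -> I = capP AA ->
  vanishes_from AA /\
  ((exists2 A, A \in AA & A != set0) -> ~ kvanish (capP AA) (#|AA|%:Z - 1) ->
   exists T, mintrans AA T /\ #|T| = #|AA|).
Proof.
elim=> {I} [I _ prim|I x k _ _ spl dec1 IH1 dec0 IH0] AA anti IE.
  rewrite IE in prim; have [A ->] := primary_capP anti prim; split.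
    by move=> e; rewrite cards1 => le; apply: kvanish_primeP; lia.
  case=> B; rewrite inE => /eqP -> /set0Pn[y yA] _.
  exists [set y]; rewrite !cards1; split=> //; apply/mintransP; split.
    by rewrite hits_set1 hit_ind; apply/set0Pn; exists y; rewrite !inE eqxx yA.
  move=> i; rewrite inE => /eqP ->; rewrite hits_set1 hit_ind negbK.
  by apply/eqP/setP => z; rewrite !inE; case: eqP; rewrite ?andbF.
rewrite {I}IE in spl dec1 IH1 dec0 IH0.
have k1 := splits_exponent anti spl; rewrite {k}k1 in spl dec1 IH1 dec0 IH0.
have [E1 E0 c1 c0] := decomposition_capP anti spl (assdec_proper dec1).
have anti1 : antichain (with_var x AA).
  by apply: antichain_sub anti; apply/subsetP => A; rewrite inE => /andP[].
have anti0 : antichain (without_var x AA).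
  by apply: antichain_sub anti; apply/subsetP => A; rewrite inE => /andP[].
have [v1 _] := IH1 _ anti1 E1; have [v0 top0] := IH0 _ anti0 E0.
split; first exact: vanishes_from_decomposition spl _ _ _ _.
move=> _ nv; have [c11 nv0] := extremal_decomposition anti spl c0 c1 v1 v0 nv.
have [|T [Tmin cT]] := top0 _ nv0.
  have /set0Pn[A A0] : without_var x AA != set0 by rewrite -card_gt0.
  exists A => //; apply/eqP => A00; rewrite {A}A00 in A0.
  have /set0Pn[B] : with_var x AA != set0 by rewrite -card_gt0.
  move: A0; rewrite !inE => /andP[A0 _] /andP[B1 xB].
  by have := anti _ _ A0 B1 (sub0set _) => B0; rewrite -B0 inE in xB.
exact: mintrans_extend spl c11 c0 Tmin cT.
Qed.

End Regularity.

(** * Minimal generators *)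

Section Generators.
Local Open Scope ring_scope.
Variables (K : fieldType) (n : nat).
Local Notation R := {mpoly K[n]}.
Implicit Types (f : R) (g m u : 'X_{1..n}) (G : set 'X_{1..n}).
Implicit Types (A B T : {set 'I_n}) (AA : {set {set 'I_n}}) (i x : 'I_n) (e : int).
Local Notation capP := (@capP K n).

Lemma mdeg_ind T : mdeg (ind T) = #|T|.
Proof.
rewrite mdegE (eq_bigr (fun i => (i \in T : nat))) => [|i _]; last by rewrite mnmE.
by rewrite -sum1_card [RHS]big_mkcond; apply: eq_bigr => i _; case: (i \in T).
Qed.

Lemma monomials_gen_capP AA G :
  capP AA = monomials_gen K G <-> hits AA =1 mono_gen G.
Proof. by rewrite monomials_genE; exact: mideal_eq. Qed.

Lemma mintrans_max_gen_degree AA T : mintrans AA T -> #|T| = #|AA| ->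
  max_gen_degree (capP AA) #|AA|.
Proof.
move=> Tmin cT; pose G : set 'X_{1..n} := fun m => exists2 T, mintrans AA T & m = ind T.
exists G; split; last split; first split.
- apply/monomials_gen_capP => m; apply/idP/asboolP => [|[_ [[T' /mintransP[hT' _] ->] le]]].
    rewrite -hits_supp => h.
    have [T' T'min sub] := @minset_exists _ (fun T => hits AA (ind T)) (supp m) h.
    by exists (ind T'); split; [exists T'|rewrite ind_lem].
  exact: hits_lem hT'.
- move=> G' sub /monomials_gen_capP E; apply/funext => u; apply/propext; split=> [/sub //|].
  case=> U Umin ->; have := Umin => /mintransP[hU _].
  move: hU; rewrite E => /asboolP[g [G'g]]; have [U' U'min gE] := sub _ G'g.
  rewrite gE ind_lem supp_ind in G'g * => subU.
  have /minsetP[_ /(_ U')] := Umin; move/mintransP: U'min => [hU' _].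
  by move=> /(_ hU' subU) <-.
- by exists (ind T); [exists T|rewrite mdeg_ind].
- by move=> _ [U Umin ->]; rewrite mdeg_ind; exact: mintrans_card.
Qed.

(** Otherwise [u] could be removed from the generating set. *)
Lemma minimal_generators_lem (I : set R) G g u :
  minimal_monomial_generators I G -> G g -> G u -> (g <= u)%MM -> g = u.
Proof.
case=> IE Gmin Gg Gu gu; apply: contrapT => ngu.
pose G' : set 'X_{1..n} := fun m => G m /\ m <> u.
have G'E : G' = G.
  apply: Gmin => [m []//|]; rewrite IE !monomials_genE; apply/mideal_eq => m.
  apply/asboolP/asboolP => -[h [Gh hm]]; last by exists h; split=> //; case: Gh.
  have [hu|hu] := pselect (h = u); last by exists h.
  by exists g; split=> //; apply: lepm_trans gu _; rewrite -hu.
by have : G' u by [rewrite G'E]; case.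
Qed.

Lemma max_gen_degree_mintrans AA r : max_gen_degree (capP AA) r ->
  exists2 T, mintrans AA T & #|T| = r.
Proof.
case=> G [Gmin [[u Gu ur] _]].
have /monomials_gen_capP E : capP AA = monomials_gen K G by case: Gmin.
have hu : hits AA u by rewrite E; apply/asboolP; exists u; split=> //; exact: lepm_refl.
have below m : hits AA m -> (m <= u)%MM -> (u <= m)%MM.
  rewrite E => /asboolP[g [Gg gm]] mu.
  by rewrite -(minimal_generators_lem Gmin Gg Gu (lepm_trans gm mu)).
have su : (ind (supp u) <= u)%MM by rewrite ind_lem.
have uE : u = ind (supp u).
  have /mnm_lepP le1 : (u <= ind (supp u))%MM by apply: below; rewrite ?hits_supp.
  by apply/mnmP => i; apply/eqP; rewrite eqn_leq le1 /=; move/mnm_lepP: su; apply.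
exists (supp u); last by rewrite -mdeg_ind -uE.
apply/minsetP; split=> [|T hT sub]; first by rewrite hits_supp.
apply/eqP; rewrite eqEsubset sub /=.
have := below _ hT; rewrite ind_lem => /(_ sub); rewrite {1}uE ind_lem.
by rewrite supp_ind.
Qed.

Lemma mintrans_tor AA T : AA != set0 -> mintrans AA T ->
  tor_neq0 (capP AA) 1 #|T|%:Z.
Proof.
move=> AA0 Tmin.
pose V := {T : {set 'I_n} | hits AA (ind T)}.
pose g (v : V) := ind (val v) : 'X_{1..n}.
have -> : capP AA = mideal (gen_by g).
  apply/mideal_eq => m; apply/idP/existsP => [h|[v vm]].
    have h' : hits AA (ind (supp m)) by rewrite hits_supp.
    by exists (exist _ (supp m) h'); rewrite /g /= ind_lem.
  exact: hits_lem vm (valP v).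
have hT : hits AA (ind T) by case/mintransP: Tmin.
pose u : V := exist _ T hT.
have := @tor1_neq0 K n V g u; rewrite /g /= mdeg_ind; apply.
  apply: contraTneq (hT) => ->; apply/hitsP => h.
  by have /set0Pn[A AAA] := AA0; have := h A AAA; rewrite hit0.
move=> v; rewrite ind_lem supp_ind => sub; apply: val_inj => /=.
by have /minsetP[_ h] := Tmin; apply: h sub; exact: valP v.
Qed.

Lemma vars_ideal A :
  ideal_gen [set ('X_i : R) | i in [set` A]]%classic = mideal (hit A).
Proof.
pose M : set 'X_{1..n} := [set U_(i)%MM | i in [set` A]]%classic.
have -> : [set ('X_i : R) | i in [set` A]]%classic = [set 'X_[m] | m in M]%classic.
  by rewrite /M image_comp.
rewrite -/(monomials_gen K M) monomials_genE; apply/mideal_eq => m.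
apply/asboolP/hitP => [[_ [[i iA <-]]]|[i iA mi]].
  by rewrite lep1mP -lt0n; exists i.
by exists U_(i)%MM; split; [exists i|rewrite lep1mP -lt0n].
Qed.

(** Each monomial of I lies in the prime generated by [B], so it is divisible by a
variable of [B] other than x, which is in I, or by x. *)
Lemma capP_with_var1 AA x B : antichain AA -> ass_splits (capP AA) x 1 ->
    with_var x AA = [set B] ->
  capP AA = ideal_add (ideal_gen [set ('X_i : R) | i in [set` B :\ x]]%classic)
                      (ideal_scale 'X_x (colonX (capP AA) x 1)).
Proof.
move=> anti spl BE; rewrite vars_ideal.
have sub := with_var1_sub anti spl BE.
have BAA : B \in AA by have := set11 B; rewrite -BE inE => /andP[].
have pI f : mideal (hit (B :\ x)) f -> capP AA f.
  move=> h m /h /hitP[i]; rewrite !inE => /andP[ix iB] mi.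
  by apply/hitsP => A AAA; apply/hitP; exists i => //; apply: sub A AAA.
apply/funext => f; apply/propext; split=> [fI|[a [_ [aU [h hI <-] ->]]]]; last first.
  apply: midealD; first exact: pI.
  by move: hI; rewrite /colonX /colon /= expr1 mulrC.
have [|[a h] [/= fE aU _]] := @mideal_split K n (hit (B :\ x)) x f.
  move=> m /fI /hitsP /(_ B BAA) /hitP[i iB mi].
  have [<-|ix] := eqVneq i x; first by rewrite mi orbT.
  by apply/orP; left; apply/hitP; exists i; rewrite // !inE ix.
exists a, ('X_x * h); split=> //; exists h => //.
rewrite /colonX /colon /= expr1 mulrC.
have -> : 'X_x * h = f - a by rewrite fE addrC addKr.
by apply: midealB => //; exact: pI.
Qed.

End Generators.

Theorem proposition3p10 (K : fieldType) (n : nat) (I : set {mpoly K[n]})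
    (x : 'I_n) (r : nat) :
  squarefree_monomial_ideal I ->
  ass_decomposable I ->
  decomposing_variable I x ->
  irreducibility_index I r ->
  (regularity_quot I (r%:Z - 1)%R <-> max_gen_degree I r) /\
  (regularity_quot I (r%:Z - 1)%R /\ max_gen_degree I r ->
    exists p J : set {mpoly K[n]},
      [/\ monomial_prime_ideal p,
          ass_decomposable J
        & I = ideal_add p (ideal_scale 'X_x%R J)]).
Proof.
move=> /squarefree_capP[AA [anti IE]] dec [spl dec1 dec0]; rewrite {I}IE in dec spl dec1 dec0 *.
move=> /(irreducibility_index_card anti) ->{r}.
have [E1 E0 c1 c0] := decomposition_capP anti spl (assdec_proper dec1).
have anti1 : antichain (with_var x AA).
  by apply: antichain_sub anti; apply/subsetP => A; rewrite inE => /andP[].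
have anti0 : antichain (without_var x AA).
  by apply: antichain_sub anti; apply/subsetP => A; rewrite inE => /andP[].
have [v1 _] := assdec_regularity dec1 anti1 E1; have [v0 _] := assdec_regularity dec0 anti0 E0.
have [van top] := assdec_regularity dec anti erefl.
have AA0 : AA != set0 by apply/(@capP_proper K)/assdec_proper.
have topE : regularity_quot (capP K AA) (#|AA|%:Z - 1)%R ->
    ~ kvanish (capP K AA) (#|AA|%:Z - 1)%R.
  by case=> -[i [j [/tor_neq0_kvanish nv <-]]] _; apply: nv; exact: hits_upclosed.
split; first split.
- move=> /topE /top[|T [Tmin cT]]; last exact: mintrans_max_gen_degree Tmin cT.
  have /set0Pn[B] : with_var x AA != set0 by rewrite -card_gt0.
  by rewrite inE => /andP[BAA xB]; exists B => //; apply/set0Pn; exists x.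
- move=> /max_gen_degree_mintrans[T Tmin cT]; split.
    by exists 1%N, #|AA|%:Z%R; split=> //; rewrite -cT; exact: mintrans_tor.
  move=> i j /tor_neq0_kvanish nv.
  apply: contra_notT (nv (@hits_upclosed _ AA)) => lt; apply: van; lia.
move=> [/topE nv _].
have [/eqP/cards1P[B BE] _] := extremal_decomposition anti spl c0 c1 v1 v0 nv.
exists (ideal_gen [set ('X_i : {mpoly K[n]})%R | i in [set` B :\ x]]%classic),
  (colonX (capP K AA) x 1); split=> //; first by exists (B :\ x).
exact: capP_with_var1.
Qed.
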